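(* Let $\mathcal G$ be a discrete measured groupoid. There is an isomorphism of Hilbert spaces between $L^2(\mathcal G)$ and $\int_{\mathcal G_0}^\oplus l^2(s^*x)\,d\mu(x)$ which sends a function $F\colon\mathcal G\to\mathbb C$ to the section $$x\mapsto\sum_{\gamma\in s^*x}F(\gamma)\cdot\zeta_\gamma.$$ Under this isomorphism elements of $\mathbb C\mathcal G$ are decomposable, and an operator $T\in\mathbb C\mathcal G$ corresponds to the operator $\int^\oplus_{\mathcal G_0}T_x\,d\mu(x)$. Furthermore, $$\tau_{\mathcal G}(T)=\int_{\mathcal G_0}\langle T_x(\zeta_x),\zeta_x\rangle_{l^2(s^*x)}\,d\mu(x).$$
   Context: Measurable spaces are standard Borel spaces; all sets and functions are measurable. A groupoid $\mathcal G$ is a small category all of whose morphisms are invertible; $\mathcal G_0$ is its set of objects, $\mathcal G$ also denotes its set of morphisms, and $\mathcal G_0\subset\mathcal G$ via identity morphisms (so $\zeta_x$ for $x\in\mathcal G_0$ is the basis vector of the identity morphism of $x$). $s,r\colon\mathcal G\to\mathcal G_0$ are source and range; the composition of $\gamma\colon x\to y$ and $\gamma'\colon y\to z$ is written $\gamma\gamma'\colon x\to z$; $i(\gamma)=\gamma^{-1}$; $s^*x:=s^{-1}(x)$. $\mathcal G$ is discrete measured: $\mathcal G$ is a measurable space, $\mathcal G_0$ a measurable subset, $s,r$ have countable fibers, the structure maps are measurable, and $\mathcal G_0$ carries a (finite) measure $\mu$ such that $U\mapsto\int_{\mathcal G_0}|r^{-1}(x)\cap U|\,d\mu(x)$ and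 $U\mapsto\int_{\mathcal G_0}|s^{-1}(x)\cap U|\,d\mu(x)$ coincide; this measure on $\mathcal G$ is also denoted $\mu$, and $L^2(\mathcal G)$ is taken with respect to it. A measurable edge is a map $\phi\colon \operatorname{Dom}(\phi)\to\mathcal G$, $\operatorname{Dom}(\phi)\subset\mathcal G_0$, such that $s\circ\phi$ is the inclusion and $r\circ\phi$ is injective. Its inverse $\phi^{-1}$ has domain $r(\operatorname{Im}\phi)$ and $\phi^{-1}(r(\phi(x)))=i(\phi(x))$. A measurable edge acts on $L^2(\mathcal G)$ by $\phi(F)(\gamma)=F(\gamma\,\phi^{-1}(r(\gamma)))$ if $r(\gamma)\in\operatorname{Dom}(\phi^{-1})$ and $0$ otherwise; $f\in L^\infty(\mathcal G_0)$ acts by $f(F)(\gamma)=f(r(\gamma))F(\gamma)$. The groupoid ring $\mathbb C\mathcal G$ is the ring of bounded operators on $L^2(\mathcal G)$ generated by measurable edges and $L^\infty(\mathcal G_0)$; each of its elements is a finite sum $T=\sum_i\phi_if_i$ with $\phi_i$ measurable edges and $f_i\in L^\infty(\mathcal G_0)$. The trace is $\tau_{\mathcal G}(T)=\langle T\chi_0,\chi_0\rangle_{L^2(\mathcal G)}$, $\chi_0$ the characteristic function of $\mathcal G_0\subset\mathcal G$. For $T$ represented by $\sum_i\phi_if_i$ and $x\in\mathcal G_0$, $T_x\colon l^2(s^*x)\to l^2(s^*x)$ is the operator (the convolution operator on the Cayley diagram of $x$) given on the standard basis vectors by $T_x\zeta_\alpha=\sum_{i:\ r(\alpha)\in\operatorname{Dom}(\phi_i)}f_i(r(\alpha))\,\zeta_{\alpha\,\phi_i(r(\alpha))}$.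 The field $x\mapsto l^2(s^*x)$ of Hilbert spaces over $\mathcal G_0$ is made into a measurable field by the sections $S_{\psi_j}$, where $S_\phi(x)=\zeta_{\phi(x)}$ if $x\in\operatorname{Dom}(\phi)$ and $S_\phi(x)=0$ otherwise, and $(\psi_j)$ is a countable family of measurable edges whose images are disjoint and have union $\mathcal G$ (such a family exists). *)

(* Defs.v *)
From HB Require Import structures.
From mathcomp Require Import all_boot all_order all_algebra.
From mathcomp Require Import finmap.
From mathcomp Require Import complex.
From mathcomp Require Import all_classical all_reals all_analysis.
From mathcomp Require Import measurable_realfun ring lra.

Set Implicit Arguments.
Unset Strict Implicit.
Unset Printing Implicit Defensive.

Import Order.TTheory GRing.Theory Num.Theory.

Local Open Scope classical_set_scope.
Local Open Scope ring_scope.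
Local Open Scope complex_scope.

Section quotmod.
Context (K : pzRingType) (V : lmodType K) (N : {pred V}).
Hypothesis subN : submod_closed N.

#[local] HB.instance Definition _ := GRing.isSubmodClosed.Build K V N subN.

Definition quotmod := Quotient.quot N.
Notation Q := quotmod.

HB.instance Definition _ := GRing.Zmodule.on Q.

Definition qclass (v : V) : Q := \pi_(Quotient.quot N)%qT v.
Definition qrepr (q : Q) : V := repr (q : Quotient.quot N).

Lemma qreprK : cancel qrepr qclass.
Proof. exact: reprK. Qed.

Lemma qclassP (u v : V) : reflect (qclass u = qclass v) (u - v \in N).
Proof. by rewrite Quotient.idealrBE; exact: eqP. Qed.

Let qclassD (u v : V) : qclass (u + v) = qclass u + qclass v.
Proof. exact: (raddfD \pi_(Quotient.quot N)%qT). Qed.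

Definition qscale (k : K) (q : Q) : Q := qclass (k *: qrepr q).

Let qscale_class k (v : V) : qscale k (qclass v) = qclass (k *: v).
Proof.
apply/qclassP; rewrite -scalerBr rpredZ//.
by apply/qclassP; rewrite qreprK.
Qed.

Let qscaleA a b (q : Q) : qscale a (qscale b q) = qscale (a * b) q.
Proof. by rewrite [qscale b q]/qscale qscale_class scalerA. Qed.

Let qscale1 : left_id 1 qscale.
Proof. by move=> q; rewrite /qscale scale1r qreprK. Qed.

Let qscaleDr : right_distributive qscale +%R.
Proof.
move=> a u v; rewrite -[u]qreprK -[v]qreprK.
by rewrite -qclassD !qscale_class scalerDr qclassD.
Qed.

Let qscaleDl (q : Q) : {morph qscale^~ q : a b / a + b}.
Proof. by move=> a b; rewrite /qscale scalerDl qclassD. Qed.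

HB.instance Definition _ := GRing.Zmodule_isLmodule.Build K Q
  qscaleA qscale1 qscaleDr qscaleDl.

Lemma qclass_is_linear : linear qclass.
Proof.
by move=> a u v; rewrite qclassD -[a *: qclass u]/(qscale _ _) qscale_class.
Qed.

End quotmod.

Local Notation Re := complex.Re.
Local Notation Im := complex.Im.

Section complex_valued.
Context (R : realType).
Implicit Types z : R[i].

Definition sqnorm z : R := Re z ^+ 2 + Im z ^+ 2.

Lemma sqnorm_ge0 z : 0 <= sqnorm z.
Proof. by rewrite addr_ge0// sqr_ge0. Qed.

Lemma sqnorm0 : sqnorm 0 = 0.
Proof. by rewrite /sqnorm/= expr0n/= addr0. Qed.

Lemma sqnormE z : (sqnorm z)%:C = `|z| ^+ 2.
Proof. by rewrite normc_def -rmorphXn sqr_sqrtr ?sqnorm_ge0. Qed.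

Lemma sqnorm_lin a z z' :
  sqnorm (a * z + z') <= 2 * (sqnorm a * sqnorm z) + 2 * sqnorm z'.
Proof.
case: a z z' => [a a'] [x x'] [y y']; rewrite /sqnorm/= -subr_ge0.
have -> : 2 * ((a ^+ 2 + a' ^+ 2) * (x ^+ 2 + x' ^+ 2)) + 2 * (y ^+ 2 + y' ^+ 2)
    - ((a * x - a' * x' + y) ^+ 2 + (a * x' + a' * x + y') ^+ 2) =
    (a * x - a' * x' - y) ^+ 2 + (a * x' + a' * x - y') ^+ 2 by ring.
by rewrite addr_ge0// sqr_ge0.
Qed.

(* Sum over an arbitrary index set; meaningful for absolutely summable families. *)
Definition rsum (T : choiceType) (A : set T) (f : T -> R) : R :=
  fine (\esum_(t in A) (EFin \o f)^\+%E t)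
  - fine (\esum_(t in A) (EFin \o f)^\-%E t).

Definition csum (T : choiceType) (A : set T) (f : T -> R[i]) : R[i] :=
  Complex (rsum A (fun t => Re (f t))) (rsum A (fun t => Im (f t))).

Lemma esum_single (T : choiceType) (A : set T) (f : T -> \bar R) t : A t ->
  (forall u, 0 <= f u)%E -> (forall u, u <> t -> f u = 0%E) ->
  \esum_(u in A) f u = f t.
Proof.
move=> At f0 ft; rewrite (esumID [set t] A f (fun u _ => f0 u)).
have -> : \esum_(u in A `&` ~` [set t]) f u = 0%E.
  by apply: esum1 => u [_ /= /ft].
rewrite adde0 (_ : A `&` _ = [set t]) ?esum_set1//.
by apply/seteqP; split=> [u []//|u /= ->].
Qed.

Lemma rsum_single (T : choiceType) (A : set T) (f : T -> R) t : A t ->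
  (forall u, u <> t -> f u = 0) -> rsum A f = f t.
Proof.
move=> At ft; rewrite /rsum (esum_single At) ?(esum_single At)//.
- rewrite funeposE funenegE /= -!EFin_max /= /Num.max.
  by case: ltrP => ?; case: ltrP => ?; lra.
- by move=> u /ft fu; rewrite funenegE /= fu oppr0 maxxx.
- by move=> u /ft fu; rewrite funeposE /= fu maxxx.
Qed.

Context d (T : measurableType d) (mu : {measure set T -> \bar R}).

Definition cmeasurable (f : T -> R[i]) :=
  measurable_fun setT (fun x => Re (f x)) /\
  measurable_fun setT (fun x => Im (f x)).

Definition cintegral (f : T -> R[i]) : R[i] :=
  Complex (\int[mu]_x Re (f x)) (\int[mu]_x Im (f x)).

Definition Linfty (f : T -> R[i]) :=
  cmeasurable f /\ exists M : R, {ae mu, forall x, `|f x| <= M%:C}.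

Lemma cmeasurable_lin a f g : cmeasurable f -> cmeasurable g ->
  cmeasurable (a *: f + g).
Proof.
move=> [mf mf'] [mg mg']; split.
- rewrite (_ : (fun x => _) = (fun x => (Re a * Re (f x) - Im a * Im (f x)) + Re (g x))).
    apply: measurable_funD => //; apply: measurable_funB; exact: measurable_funM.
  by apply/funext => x; rewrite !fctE; case: a (f x) (g x) => [? ?] [? ?] [? ?].
- rewrite (_ : (fun x => _) = (fun x => (Re a * Im (f x) + Im a * Re (f x)) + Im (g x))).
    apply: measurable_funD => //; apply: measurable_funD; exact: measurable_funM.
  by apply/funext => x; rewrite !fctE; case: a (f x) (g x) => [? ?] [? ?] [? ?].
Qed.

Lemma cmeasurable0 : cmeasurable 0.
Proof. by split; exact: measurable_cst. Qed.

Lemma measurable_sqnorm f : cmeasurable f ->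
  measurable_fun setT (fun x => (sqnorm (f x))%:E).
Proof.
move=> [mf mf']; apply/measurable_EFinP.
by apply: measurable_funD; exact: measurable_funX.
Qed.

Definition sqint : {pred T -> R[i]} :=
  mem [set f | cmeasurable f /\ (\int[mu]_x (sqnorm (f x))%:E < +oo)%E].

Lemma sqint_submod_closed : submod_closed sqint.
Proof.
split.
  rewrite inE; split; first exact: cmeasurable0.
  by rewrite integral0_eq ?ltry// => x _; rewrite sqnorm0.
move=> a f g; rewrite !inE => -[mf If] [mg Ig]; split.
  exact: cmeasurable_lin.
apply: (@le_lt_trans _ _ (\int[mu]_x
    ((2 * sqnorm a)%:E * (sqnorm (f x))%:E + 2%:E * (sqnorm (g x))%:E))%E).
  apply: ge0_le_integral => //.
  - by move=> x _; rewrite lee_fin sqnorm_ge0.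
  - by apply: measurable_sqnorm; exact: cmeasurable_lin.
  - by apply: emeasurable_funD; apply: measurable_funeM; exact: measurable_sqnorm.
  - move=> x _; rewrite -!EFinM -EFinD lee_fin -mulrA.
    exact: sqnorm_lin.
have h0 (h : T -> R[i]) x : (0 <= (sqnorm (h x))%:E)%E.
  by rewrite lee_fin sqnorm_ge0.
rewrite ge0_integralD//; last 4 first.
- by move=> x _; rewrite mule_ge0// lee_fin mulr_ge0 ?sqnorm_ge0.
- by apply: measurable_funeM; exact: measurable_sqnorm.
- by move=> x _; rewrite mule_ge0.
- by apply: measurable_funeM; exact: measurable_sqnorm.
rewrite !ge0_integralZl//.
- by rewrite lte_add_pinfty// lte_mul_pinfty// lee_fin mulr_ge0 ?sqnorm_ge0.
- exact: measurable_sqnorm.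
- exact: measurable_sqnorm.
- by rewrite lee_fin mulr_ge0 ?sqnorm_ge0.
Qed.

HB.instance Definition _ :=
  GRing.isSubmodClosed.Build _ _ sqint sqint_submod_closed.

Record sqint_fun := SqintFun { sqint_val :> T -> R[i] ; _ : sqint_val \in sqint }.
HB.instance Definition _ := [isSub for sqint_val].
HB.instance Definition _ := [Choice of sqint_fun by <:].
HB.instance Definition _ := [SubChoice_isSubLmodule of sqint_fun by <:].

Definition ae_null : {pred sqint_fun} :=
  mem [set f : sqint_fun | {ae mu, forall x, f x = 0}].

Lemma ae_null_submod_closed : submod_closed ae_null.
Proof.
split; first by rewrite inE; exact: aeW.
move=> a f g; rewrite !inE => f0 g0.
by apply: filterS2 f0 g0 => x; rewrite /= !fctE => -> ->; rewrite scaler0 addr0.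
Qed.

Definition L2 := quotmod ae_null_submod_closed.
HB.instance Definition _ := GRing.Lmodule.on L2.

(* The class of [f]; junk value [0] when [f] is not square-integrable. *)
Definition L2class (f : T -> R[i]) : L2 := qclass _ (insubd (0 : sqint_fun) f).
Definition L2repr (u : L2) : T -> R[i] := val (qrepr u).

Definition L2inner (u v : L2) : R[i] :=
  cintegral (fun x => L2repr u x * (L2repr v x)^*)%C.

End complex_valued.

Section l2.
Context (R : realType) (T : choiceType) (A : set T).

(* Families indexed by [A] are extended by [0] outside of [A]. *)
Definition sqsummable : {pred T -> R[i]} :=
  mem [set a | (forall t, ~ A t -> a t = 0) /\
               (\esum_(t in A) (sqnorm (a t))%:E < +oo)%E].

Lemma le_esumZ (c : R) (h : T -> R) : 0 <= c -> (forall t, 0 <= h t) ->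
  (\esum_(t in A) (c * h t)%:E <= c%:E * \esum_(t in A) (h t)%:E)%E.
Proof.
move=> c0 h0; apply: ge_ereal_sup => _ [F [finF FA] <-].
rewrite fsbig_finite//=; under eq_bigr do rewrite EFinM.
rewrite -ge0_sume_distrr; last by move=> t _; rewrite lee_fin.
rewrite lee_wpmul2l ?lee_fin//.
by apply: esum_ge; exists F => //; rewrite fsbig_finite.
Qed.

Lemma esum_sqnorm_lin k (a b : T -> R[i]) :
  (\esum_(t in A) (sqnorm ((k *: a + b) t))%:E <=
   (2 * sqnorm k)%:E * (\esum_(t in A) (sqnorm (a t))%:E)
   + 2%:E * (\esum_(t in A) (sqnorm (b t))%:E))%E.
Proof.
have h0 (h : T -> R[i]) t : 0 <= sqnorm (h t) by exact: sqnorm_ge0.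
have k0 : 0 <= 2 * sqnorm k by rewrite mulr_ge0// sqnorm_ge0.
apply: (@le_trans _ _ (\esum_(t in A)
    ((2 * sqnorm k * sqnorm (a t))%:E + (2 * sqnorm (b t))%:E))%E).
  apply: le_esum => t At; rewrite -EFinD lee_fin -mulrA.
  exact: sqnorm_lin.
rewrite esumD; [|by move=> t _; rewrite lee_fin mulr_ge0..].
by apply: leeD; exact: le_esumZ.
Qed.

Lemma sqsummable_submod_closed : submod_closed sqsummable.
Proof.
split.
  rewrite inE; split=> //.
  by rewrite esum1 ?ltry// => t _; rewrite sqnorm0.
move=> k a b; rewrite !inE => -[a0 Sa] [b0 Sb]; split.
  by move=> t At; rewrite !fctE a0// b0// scaler0 addr0.
apply: le_lt_trans (esum_sqnorm_lin k a b) _.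
by rewrite lte_add_pinfty// lte_mul_pinfty// ?lee_fin// ?mulr_ge0 ?sqnorm_ge0//;
  apply: esum_ge0 => t _; rewrite lee_fin sqnorm_ge0.
Qed.

HB.instance Definition _ :=
  GRing.isSubmodClosed.Build _ _ sqsummable sqsummable_submod_closed.

Record l2 := L2Fam { l2_val :> T -> R[i] ; _ : l2_val \in sqsummable }.
HB.instance Definition _ := [isSub for l2_val].
HB.instance Definition _ := [Choice of l2 by <:].
HB.instance Definition _ := [SubChoice_isSubLmodule of l2 by <:].

Implicit Types a b : l2.

(* Inner products are linear in the first argument. *)
Definition l2inner a b : R[i] := csum A (fun t => a t * (b t)^*)%C.

Definition l2norm a : R := Num.sqrt (fine (\esum_(t in A) (sqnorm (a t))%:E)%E).

Lemma l2norm_sqr a : (l2norm a ^+ 2)%:E = \esum_(t in A) (sqnorm (a t))%:E.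
Proof.
have := valP a; rewrite inE => -[_ Sa].
have S0 : (0 <= \esum_(t in A) (sqnorm (a t))%:E)%E.
  by apply: esum_ge0 => t _; rewrite lee_fin sqnorm_ge0.
by rewrite /l2norm sqr_sqrtr ?fine_ge0// fineK// ge0_fin_numE.
Qed.

Lemma l2norm_sqr_lin k a b :
  ((l2norm (k *: a + b) ^+ 2)%:E <=
   (2 * sqnorm k)%:E * (l2norm a ^+ 2)%:E + 2%:E * (l2norm b ^+ 2)%:E)%E.
Proof. by rewrite !l2norm_sqr; exact: esum_sqnorm_lin. Qed.

Definition zeta_val (t : T) : T -> R[i] := fun u => (`[< A t >] && (u == t))%:R.

Lemma zeta_subproof t : zeta_val t \in sqsummable.
Proof.
rewrite inE; split.
  move=> u Au; rewrite /zeta_val; case: asboolP => //= At.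
  by case: eqP => // ut; rewrite ut in Au.
have [At|At] := pselect (A t); last first.
  rewrite esum1 ?ltry// => u _.
  by rewrite /zeta_val asboolF//= sqnorm0.
have zt0 u : (0 <= (sqnorm (zeta_val t u))%:E)%E by rewrite lee_fin sqnorm_ge0.
rewrite (esumID [set t] A _ (fun u _ => zt0 u)).
have -> : \esum_(u in A `&` ~` [set t]) (sqnorm (zeta_val t u))%:E = 0%E.
  apply: esum1 => u [_ /= ut].
  by rewrite /zeta_val; case: eqP => // _; rewrite andbF sqnorm0.
rewrite adde0.
rewrite (_ : A `&` _ = [set t]) ?esum_set1 ?ltry// ?lee_fin ?sqnorm_ge0//.
by apply/seteqP; split=> [u []//|u /= ->].
Qed.

(* The standard basis vector at [t]; junk value [0] when [t] is not in [A]. *)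
Definition zeta (t : T) : l2 := L2Fam (zeta_subproof t).

Lemma zetaE t u : zeta t u = (`[< A t >] && (u == t))%:R.
Proof. by []. Qed.

Lemma l2inner_zeta a t : A t -> l2inner a (zeta t) = a t.
Proof.
move=> At; rewrite /l2inner /csum !(rsum_single At).
- by rewrite zetaE asboolT// eqxx rmorph_nat mulr1; case: (a t).
- by move=> u /eqP ut; rewrite zetaE (negbTE ut) andbF rmorph_nat mulr0.
- by move=> u /eqP ut; rewrite zetaE (negbTE ut) andbF rmorph_nat mulr0.
Qed.

Lemma l2inner0r a : l2inner a 0 = 0.
Proof.
by rewrite /l2inner /csum /rsum; congr Complex; rewrite !esum1 ?subrr// => t _;
  rewrite ?funeposE ?funenegE /= rmorph0 mulr0 ?oppr0 maxxx.
Qed.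

(* [a] is the sum, in the norm of [l2 A], of the family [(c t *: zeta t)_(t in A)]. *)
Definition is_l2sum (c : T -> R[i]) (a : l2) :=
  forall e : R, 0 < e ->
  exists2 J0 : {fset T}, [set` J0] `<=` A &
  forall J : {fset T}, [set` J0] `<=` [set` J] -> [set` J] `<=` A ->
    l2norm (a - \sum_(t <- J) c t *: zeta t) < e.

Definition bounded_op (B : l2 -> l2) :=
  exists M : R, forall a, l2norm (B a) <= M * l2norm a.

End l2.
Arguments l2 R {T} A.

Definition standard_borel (R : realType) d (T : measurableType d) :=
  exists (X : completePseudoMetricType R) (f : T -> X),
  [/\ hausdorff_space X,
      exists2 D : set X, countable D & dense D,
      bijective f &
      forall A : set X, measurable (f @^-1` A) <-> (<<s [set U | open U] >>) A].

(* [gcomp g h] is the composite of [g : x -> y] followed by [h : y -> z];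
   it is only meaningful when [grng g = gsrc h]. *)
Record groupoid (Ob Mor : Type) := Groupoid {
  gsrc : Mor -> Ob ;
  grng : Mor -> Ob ;
  gid : Ob -> Mor ;
  gcomp : Mor -> Mor -> Mor ;
  ginv : Mor -> Mor ;
  gsrc_id : forall x, gsrc (gid x) = x ;
  grng_id : forall x, grng (gid x) = x ;
  gsrc_comp : forall g h, grng g = gsrc h -> gsrc (gcomp g h) = gsrc g ;
  grng_comp : forall g h, grng g = gsrc h -> grng (gcomp g h) = grng h ;
  gcomp1l : forall g, gcomp (gid (gsrc g)) g = g ;
  gcomp1r : forall g, gcomp g (gid (grng g)) = g ;
  gcompA : forall g h k, grng g = gsrc h -> grng h = gsrc k ->
    gcomp g (gcomp h k) = gcomp (gcomp g h) k ;
  gsrc_inv : forall g, gsrc (ginv g) = grng g ;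
  grng_inv : forall g, grng (ginv g) = gsrc g ;
  gcompV : forall g, gcomp g (ginv g) = gid (gsrc g) ;
  gcompVl : forall g, gcomp (ginv g) g = gid (grng g) }.

Record discrete_measured_groupoid (R : realType) d0 d
    (G0 : measurableType d0) (G : measurableType d) := DiscreteMeasuredGroupoid {
  dmg_groupoid :> groupoid G0 G ;
  borel_obj : standard_borel R G0 ;
  borel_mor : standard_borel R G ;
  (* [gid] identifies [G0] with a measurable subset of [G] *)
  measurable_gid : forall A : set G0,
    measurable A <-> measurable (gid dmg_groupoid @` A) ;
  measurable_gsrc : measurable_fun setT (gsrc dmg_groupoid) ;
  measurable_grng : measurable_fun setT (grng dmg_groupoid) ;
  measurable_ginv : measurable_fun setT (ginv dmg_groupoid) ;
  measurable_gcomp : measurable_fun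
    [set p : G * G | grng dmg_groupoid p.1 = gsrc dmg_groupoid p.2]
    (fun p => gcomp dmg_groupoid p.1 p.2) ;
  countable_gsrc : forall x, countable (gsrc dmg_groupoid @^-1` [set x]) ;
  countable_grng : forall x, countable (grng dmg_groupoid @^-1` [set x]) ;
  obj_measure : {finite_measure set G0 -> \bar R} ;
  mor_measure : {measure set G -> \bar R} ;
  mor_measure_grng : forall U, measurable U -> (mor_measure U =
    \int[obj_measure]_x counting (grng dmg_groupoid @^-1` [set x] `&` U))%E ;
  mor_measure_gsrc : forall U, measurable U -> (mor_measure U =
    \int[obj_measure]_x counting (gsrc dmg_groupoid @^-1` [set x] `&` U))%E }.

Section groupoid.
Context (R : realType) (d0 d : measure_display).
Context (G0 : measurableType d0) (G : measurableType d).
Variable Gd : discrete_measured_groupoid R G0 G.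
Notation mu0 := (obj_measure Gd).
Notation mu := (mor_measure Gd).
Notation gsrc := (gsrc Gd).
Notation grng := (grng Gd).
Notation gid := (gid Gd).
Notation gcomp := (gcomp Gd).
Notation ginv := (ginv Gd).

Definition fiber (x : G0) : set G := gsrc @^-1` [set x].

(* Only the values of [efun] on [edom] are meaningful. *)
Record edge := Edge {
  edom : set G0 ;
  efun :> G0 -> G ;
  measurable_edom : measurable edom ;
  measurable_efun : measurable_fun edom efun ;
  gsrc_efun : forall x, edom x -> gsrc (efun x) = x ;
  grng_efun_inj : forall x y, edom x -> edom y ->
    grng (efun x) = grng (efun y) -> x = y }.

Definition eimg (phi : edge) : set G := phi @` edom phi.

Definition einv_dom (phi : edge) : set G0 := grng @` eimg phi.

Definition einv (phi : edge) (y : G0) : G :=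
  ginv (phi (xget y [set x | edom phi x /\ grng (phi x) = y])).

Lemma einvE (phi : edge) x : edom phi x -> einv phi (grng (phi x)) = ginv (phi x).
Proof.
move=> px; rewrite /einv; case: xgetP => [y _ [py yx]|/(_ x)[]//].
by rewrite (grng_efun_inj py px yx).
Qed.

(* Edges may have empty domain, so finite families are included. *)
Record edge_partition := EdgePartition {
  epart :> nat -> edge ;
  epart_disj : trivIset setT (fun j => eimg (epart j)) ;
  epart_cover : \bigcup_j eimg (epart j) = setT }.

Definition edge_act (phi : edge) (F : G -> R[i]) : G -> R[i] := fun g =>
  if `[< einv_dom phi (grng g) >] then F (gcomp g (einv phi (grng g))) else 0.

Definition mult_act (f : G0 -> R[i]) (F : G -> R[i]) : G -> R[i] :=
  fun g => f (grng g) * F g.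

(* On square-integrable functions, [edge_act phi] and [mult_act f] (for [f] in
   [Linfty]) preserve square-integrability and almost everywhere equality, so
   the junk value of [L2class] and the choice of representatives play no role. *)
Definition edge_op (phi : edge) (u : L2 mu) : L2 mu :=
  L2class mu (edge_act phi (L2repr u)).

Definition mult_op (f : G0 -> R[i]) (u : L2 mu) : L2 mu :=
  L2class mu (mult_act f (L2repr u)).

(* Scalars and the identity are covered by [mult_op] of constant functions. *)
Inductive groupoid_ring : (L2 mu -> L2 mu) -> Prop :=
| groupoid_ring_edge phi : groupoid_ring (edge_op phi)
| groupoid_ring_mult f : Linfty mu0 f -> groupoid_ring (mult_op f)
| groupoid_ring_add S T : groupoid_ring S -> groupoid_ring T ->
    groupoid_ring (fun u => S u + T u)
| groupoid_ring_opp T : groupoid_ring T -> groupoid_ring (fun u => - T u)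
| groupoid_ring_comp S T : groupoid_ring S -> groupoid_ring T ->
    groupoid_ring (fun u => S (T u)).

Definition represents n (phi : 'I_n -> edge) (f : 'I_n -> G0 -> R[i])
    (T : L2 mu -> L2 mu) :=
  (forall i, Linfty mu0 (f i)) /\
  (forall u, T u = \sum_(i < n) edge_op (phi i) (mult_op (f i) u)).

Definition chi0 : L2 mu := L2class mu (fun g => (`[< range gid g >])%:R).

Definition trace (T : L2 mu -> L2 mu) : R[i] := L2inner (T chi0) chi0.

(* A bounded linear [B] satisfying this is the convolution operator [T_x] of the
   operator [T] represented by the sum of the [phi_i f_i]. *)
Definition is_convop n (phi : 'I_n -> edge) (f : 'I_n -> G0 -> R[i])
    (x : G0) (B : l2 R (fiber x) -> l2 R (fiber x)) :=
  forall a, gsrc a = x ->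
    B (zeta R (fiber x) a) =
    \sum_(i < n | `[< edom (phi i) (grng a) >])
      f i (grng a) *: zeta R (fiber x) (gcomp a (phi i (grng a))).

Definition hsection := forall x : G0, l2 R (fiber x).

HB.instance Definition _ := Choice.on hsection.

Section hsection_lmodule.
Implicit Types xi eta : hsection.

Let addA : associative (fun xi eta => (fun x => xi x + eta x) : hsection).
Proof. by move=> a b c; apply: functional_extensionality_dep => x; exact: addrA. Qed.
Let addC : commutative (fun xi eta => (fun x => xi x + eta x) : hsection).
Proof. by move=> a b; apply: functional_extensionality_dep => x; exact: addrC. Qed.
Let add0 : left_id ((fun x => 0) : hsection)
  (fun xi eta => (fun x => xi x + eta x) : hsection).
Proof. by move=> a; apply: functional_extensionality_dep => x; exact: add0r. Qed.
Let addN : left_inverse ((fun x => 0) : hsection)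
  (fun xi => (fun x => - xi x) : hsection)
  (fun xi eta => (fun x => xi x + eta x) : hsection).
Proof. by move=> a; apply: functional_extensionality_dep => x; exact: addNr. Qed.

HB.instance Definition _ := GRing.isZmodule.Build hsection addA addC add0 addN.

Let scale (k : R[i]) xi : hsection := fun x => k *: xi x.
Let scaleA a b xi : scale a (scale b xi) = scale (a * b) xi.
Proof. by apply: functional_extensionality_dep => x; exact: scalerA. Qed.
Let scale1 : left_id 1 scale.
Proof. by move=> xi; apply: functional_extensionality_dep => x; exact: scale1r. Qed.
Let scaleDr : right_distributive scale +%R.
Proof.
by move=> a xi eta; apply: functional_extensionality_dep => x; exact: scalerDr.
Qed.
Let scaleDl xi : {morph scale^~ xi : a b / a + b}.
Proof.
by move=> a b; apply: functional_extensionality_dep => x; exact: scalerDl.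
Qed.

HB.instance Definition _ := GRing.Zmodule_isLmodule.Build R[i] hsection
  scaleA scale1 scaleDr scaleDl.

End hsection_lmodule.

Definition edge_section (phi : edge) : hsection := fun x =>
  if `[< edom phi x >] then zeta R (fiber x) (phi x) else 0.

Variable psi : edge_partition.

Definition measurable_section (xi : hsection) :=
  forall j, cmeasurable (fun x => l2inner (xi x) (edge_section (psi j) x)).

Lemma l2inner_edge_section (xi : hsection) phi x :
  l2inner (xi x) (edge_section phi x) =
  if `[< edom phi x >] then xi x (phi x) else 0.
Proof.
rewrite /edge_section; case: asboolP => [px|_]; last exact: l2inner0r.
by apply: l2inner_zeta; exact: gsrc_efun.
Qed.

Lemma measurable_section_lin k (xi eta : hsection) :
  measurable_section xi -> measurable_section eta ->
  measurable_section (k *: xi + eta).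
Proof.
move=> mxi meta j; have := cmeasurable_lin k (mxi j) (meta j).
congr cmeasurable; apply/funext => x; rewrite !fctE !l2inner_edge_section.
by case: asboolP => // _; rewrite scaler0 addr0.
Qed.

Lemma l2norm_sqr_fiber (xi : hsection) x : ((l2norm (xi x) ^+ 2)%:E =
  \sum_(0 <= j <oo)
    (sqnorm (l2inner (xi x) (edge_section (psi j) x)))%:E)%E.
Proof.
rewrite l2norm_sqr.
pose J j := eimg (psi j) `&` fiber x.
have {1}-> : fiber x = \bigcup_j J j.
  by rewrite -setI_bigcupl epart_cover setTI.
have h0 t : (0 <= (sqnorm (xi x t))%:E)%E by rewrite lee_fin sqnorm_ge0.
have tJ : trivIset setT J.
  by apply: trivIset_setIr; exact: epart_disj.
rewrite (esum_bigcupT _ _ tJ)//.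
rewrite nneseries_esumT; last by move=> j; rewrite lee_fin sqnorm_ge0.
apply: eq_esum => j _; rewrite l2inner_edge_section.
case: asboolP => px.
  rewrite (_ : J j = [set psi j x]) ?esum_set1//.
  apply/seteqP; split=> [_ [[y py <-]]|_ ->]; rewrite /fiber /=.
    by rewrite gsrc_efun// => <-.
  by split; [exists x|exact: gsrc_efun].
rewrite sqnorm0 (_ : J j = set0) ?esum_set0//.
apply/seteqP; split=> // _ [[y py <-]]; rewrite /fiber /= gsrc_efun// => yx.
by rewrite yx in py.
Qed.

Lemma measurable_l2norm_sqr (xi : hsection) : measurable_section xi ->
  measurable_fun setT (fun x => (l2norm (xi x) ^+ 2)%:E).
Proof.
move=> mxi; under eq_fun do rewrite l2norm_sqr_fiber.
apply: ge0_emeasurable_sum => [j x _ _|j _]; first by rewrite lee_fin sqnorm_ge0.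
exact: measurable_sqnorm.
Qed.

Definition sqint_section : {pred hsection} :=
  mem [set xi | measurable_section xi /\
                (\int[mu0]_x (l2norm (xi x) ^+ 2)%:E < +oo)%E].

Lemma sqint_section_submod_closed : submod_closed sqint_section.
Proof.
split.
  rewrite inE; split; last first.
    rewrite integral0_eq ?ltry// => x _.
    by rewrite l2norm_sqr esum1// => t _; rewrite sqnorm0.
  move=> j; rewrite [X in cmeasurable X](_ : _ = 0); first exact: cmeasurable0.
  by apply/funext => x; rewrite l2inner_edge_section; case: ifP.
move=> k xi eta; rewrite !inE => -[mxi Ixi] [meta Ieta]; split.
  exact: measurable_section_lin.
have h0 (h : hsection) x : (0 <= (l2norm (h x) ^+ 2)%:E)%E.
  by rewrite lee_fin sqr_ge0.
have k0 : 0 <= 2 * sqnorm k by rewrite mulr_ge0// sqnorm_ge0.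
apply: (@le_lt_trans _ _ (\int[mu0]_x ((2 * sqnorm k)%:E *
    (l2norm (xi x) ^+ 2)%:E + 2%:E * (l2norm (eta x) ^+ 2)%:E))%E).
  apply: ge0_le_integral => //.
  - by apply: measurable_l2norm_sqr; exact: measurable_section_lin.
  - by apply: emeasurable_funD; apply: measurable_funeM;
      exact: measurable_l2norm_sqr.
  - by move=> x _; exact: l2norm_sqr_lin.
rewrite ge0_integralD//; last 4 first.
- by move=> x _; rewrite mule_ge0.
- by apply: measurable_funeM; exact: measurable_l2norm_sqr.
- by move=> x _; rewrite mule_ge0.
- by apply: measurable_funeM; exact: measurable_l2norm_sqr.
rewrite !ge0_integralZl//.
- by rewrite lte_add_pinfty// lte_mul_pinfty.
- exact: measurable_l2norm_sqr.
- exact: measurable_l2norm_sqr.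
Qed.

HB.instance Definition _ :=
  GRing.isSubmodClosed.Build _ _ sqint_section sqint_section_submod_closed.

Record sqint_hsection :=
  SqintSection { hsection_val : hsection ; _ : hsection_val \in sqint_section }.
HB.instance Definition _ := [isSub for hsection_val].
HB.instance Definition _ := [Choice of sqint_hsection by <:].
HB.instance Definition _ := [SubChoice_isSubLmodule of sqint_hsection by <:].

Definition ae_null_section : {pred sqint_hsection} :=
  mem [set xi : sqint_hsection | {ae mu0, forall x, hsection_val xi x = 0}].

Lemma ae_null_section_submod_closed : submod_closed ae_null_section.
Proof.
split; first by rewrite inE; exact: aeW.
move=> a f g; rewrite !inE => f0 g0.
apply: filterS2 f0 g0 => x fx0 gx0.
by rewrite -[LHS]/(a *: hsection_val f x + hsection_val g x) fx0 gx0 scaler0 addr0.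
Qed.

Definition dirint := quotmod ae_null_section_submod_closed.
HB.instance Definition _ := GRing.Lmodule.on dirint.

(* The class of [xi]; junk value [0] when [xi] is not a square-integrable
   measurable section. *)
Definition dirint_class (xi : hsection) : dirint :=
  qclass _ (insubd (0 : sqint_hsection) xi).
Definition dirint_repr (u : dirint) : hsection := val (qrepr u).

Definition dirint_inner (u v : dirint) : R[i] :=
  cintegral mu0 (fun x => l2inner (dirint_repr u x) (dirint_repr v x)).

Definition opfield := forall x, {linear l2 R (fiber x) -> l2 R (fiber x)}.

Definition ess_bounded_opfield (B : opfield) :=
  [/\ forall x, bounded_op (B x),
      forall xi : hsection, measurable_section xi ->
        measurable_section (fun x => B x (xi x)) &
      exists M : R, {ae mu0, forall x,
        forall a, l2norm (B x a) <= M * l2norm a}].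

Definition dirint_op (B : opfield) (u : dirint) : dirint :=
  dirint_class (fun x => B x (dirint_repr u x)).

Definition decomposes (D : dirint -> dirint) (B : opfield) :=
  ess_bounded_opfield B /\ D = dirint_op B.

End groupoid.

(* Main.v *)
(* The measure on the groupoid integrates the counting measures of the source
   fibres, so integrating a nonnegative function over it amounts to summing over
   each fibre and then integrating over the objects; in particular a property
   holds almost everywhere iff it holds on almost every whole fibre. Hence
   restriction to fibres is a unitary, with inverse xi |-> (g |-> xi (s g) g).
   An edge acts by right translation and a function on the objects by
   multiplication through the range map; both preserve the fibres and act on
   each of them by operators with a uniform bound, so decomposability passes to
   sums and products. The fields of operators agree almost everywhere on basis
   vectors as soon as they agree on the countably many sections of the edge
   partition; this identifies the fibre operators for every representation.
   Finally the characteristic function of the units corresponds to the section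
   of basis vectors of the identities, which gives the trace formula. *)

Require Import Defs.
From HB Require Import structures.
From mathcomp Require Import all_boot all_order all_algebra.
From mathcomp Require Import finmap complex.
From mathcomp Require Import all_classical all_reals all_analysis.
From mathcomp Require Import measurable_realfun ring lra.

Set Implicit Arguments.
Unset Strict Implicit.
Unset Printing Implicit Defensive.

Import Order.TTheory GRing.Theory Num.Theory.

Local Open Scope classical_set_scope.
Local Open Scope ring_scope.

Local Notation Re := complex.Re.
Local Notation Im := complex.Im.

(** * Standard Borel spaces *)

Section standard_borel.
Context (R : realType) (d : measure_display) (T : measurableType d).
Hypothesis sbT : standard_borel R T.

(** In a Hausdorff space the interiors of the balls of radius [1/(n+1)] around a dense sequence
    separate points, and preimages of open sets are measurable. Interiors are taken because a ball
    need not be open. *)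
Lemma standard_borel_separating : exists E : nat -> nat -> set T,
  (forall k n, measurable (E k n)) /\
  (forall s t, (forall k n, E k n s -> E k n t) -> s = t).
Proof.
have [X [f [hX [D cD dD] bijf mf]]] := sbT.
have [D0|[e]] := pfcard_geP cD.
  have := dD setT (ex_intro _ point I) openT.
  by rewrite D0 setTI => -[].
exists (fun k n => f @^-1` (ball (e k) n.+1%:R^-1)°); split=> [k n|s t st].
  apply/mf; apply: sub_sigma_algebra; exact: open_interior.
have [g fK gK] := bijf; apply: (can_inj fK).
apply: contrapT => /eqP fst.
move: hX; rewrite ball_hausdorff => /(_ _ _ fst)[[r1 r2]] /= /eqP r12.
(* The centre will lie within [q / 2] of [f s] and within [q] of [f t], so [f t] falls in the ball
   of radius [2q] around [f s]. With [2q] at most both separating radii this contradicts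
   disjointness. *)
have [n rn] : exists n : nat, 2 * n.+1%:R^-1 <= Num.min r1%:num r2%:num.
  have r0 : 0 < Num.min r1%:num r2%:num / 2 by rewrite divr_gt0// lt_min !gt0.
  have [n _ /(_ n (leqnn n))] := near_infty_natSinv_lt (PosNum r0).
  by move=> /ltW /=; rewrite ler_pdivlMr// mulrC => ?; exists n.
pose q : R := n.+1%:R^-1.
have q0 : 0 < q by rewrite invr_gt0.
have q20 : 0 < q / 2 by rewrite divr_gt0.
have [y [/= ysq Dy]] : ((ball (f s) (q / 2))° `&` D) !=set0.
  apply: dD; last exact: open_interior.
  by exists (f s); exact: nbhsx_ballx.
have [k _ ek] : (e @` setT) y by exact: surj.
have fsy : ball (f s) (q / 2) y by exact: interior_subset.
have /st : (f @^-1` (ball (e k) q)°) s.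
  rewrite /= /interior ek.
  apply: filterS (nbhsx_ballx (f s) _ q20) => z fsz.
  by rewrite (splitr q); apply: ball_triangle fsz; exact: ball_sym.
move=> /interior_subset; rewrite ek => yt.
suff : (ball (f s) r1%:num `&` ball (f t) r2%:num) (f t) by rewrite r12.
split; last exact: ballxx.
apply: (@le_ball _ _ (f s) (q / 2 + q)).
  by move: rn; rewrite le_min => /andP[+ _]; rewrite -/q => ?; lra.
exact: ball_triangle fsy yt.
Qed.

(** A countable separating family tests equality through the conditions that [E k n (f s)] implies
    [E k n (g s)]. In effect the diagonal of a standard Borel space is measurable. *)
Lemma measurable_eq_fun d' (S : measurableType d') (f g : S -> T) :
  measurable_fun setT f -> measurable_fun setT g ->
  measurable [set s | f s = g s].
Proof.
have [E [mE sepE]] := standard_borel_separating => mf mg.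
rewrite (_ : [set _ | _] = \bigcap_k \bigcap_n
    (~` (f @^-1` E k n) `|` g @^-1` E k n)).
  apply: bigcap_measurableType => k _; apply: bigcap_measurableType => n _.
  by apply: measurableU; [apply: measurableC|];
    rewrite -[X in measurable X]setTI; [exact: mf|exact: mg].
apply/seteqP; split=> [s /= fgs k _ n _|s /= fgs].
  by have [?|?] := pselect (E k n (g s)); [right|left; rewrite /= fgs].
apply: sepE => k n fE.
by have /(_ k I n I)[] := fgs.
Qed.

End standard_borel.

(** * Square-integrable functions and square-summable families *)

Section L2_classes.
Context (R : realType) (d : measure_display) (T : measurableType d).
Variable mu : {measure set T -> \bar R}.
Implicit Types (F : T -> R[i]) (u : L2 mu).

Lemma sqintP F : F \in sqint mu <->
  cmeasurable F /\ (\int[mu]_x (sqnorm (F x))%:E < +oo)%E.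
Proof. by rewrite inE. Qed.

Lemma sqint_ae_eq F F' : F \in sqint mu -> cmeasurable F' ->
  {ae mu, forall x, F x = F' x} -> F' \in sqint mu.
Proof.
move=> /sqintP[mF IF] mF' FF'; apply/sqintP; split => //.
rewrite (ge0_ae_eq_integral (g := fun x => (sqnorm (F x))%:E))//.
- exact: measurable_sqnorm.
- exact: measurable_sqnorm.
- by move=> x _; rewrite lee_fin sqnorm_ge0.
- by move=> x _; rewrite lee_fin sqnorm_ge0.
- by apply: filterS FF' => x FF' _; rewrite FF'.
Qed.

Lemma L2class_eq F F' : F \in sqint mu -> F' \in sqint mu ->
  {ae mu, forall x, F x = F' x} -> L2class mu F = L2class mu F'.
Proof.
move=> sF sF' FF'; apply/qclassP; rewrite inE.
apply: filterS FF' => x FF'.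
by rewrite /= !insubdK// !fctE FF' subrr.
Qed.

Lemma L2repr_sqint u : L2repr u \in sqint mu.
Proof. exact: valP. Qed.

Lemma L2class_repr u : L2class mu (L2repr u) = u.
Proof. by rewrite /L2class /L2repr valKd qreprK. Qed.

Lemma L2repr_class F : F \in sqint mu ->
  {ae mu, forall x, L2repr (L2class mu F) x = F x}.
Proof.
move=> sF; have /qclassP := L2class_repr (L2class mu F).
rewrite inE; apply: filterS => x.
rewrite /= !insubdK ?L2repr_sqint// !fctE => /eqP.
by rewrite subr_eq0 => /eqP.
Qed.

Lemma L2class_lin a F F' : F \in sqint mu -> F' \in sqint mu ->
  L2class mu (a *: F + F') = a *: L2class mu F + L2class mu F'.
Proof.
move=> sF sF'; rewrite /L2class -qclass_is_linear; congr qclass.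
by apply: val_inj; rewrite /= !insubdK// rpredD// rpredZ.
Qed.

Lemma cintegral_ae_eq F F' : cmeasurable F -> cmeasurable F' ->
  {ae mu, forall x, F x = F' x} -> cintegral mu F = cintegral mu F'.
Proof.
move=> [mF mF'] [mG mG'] FF'; rewrite /cintegral /Rintegral.
congr (Complex (fine _) (fine _)); apply: ae_eq_integral => //;
  [exact/measurable_EFinP..| |exact/measurable_EFinP|exact/measurable_EFinP|];
  by apply: filterS FF' => x -> _.
Qed.

End L2_classes.

Section l2_families.
Context (R : realType) (T : choiceType) (A : set T).
Implicit Types a b : l2 R A.

Lemma l2_out a t : ~ A t -> a t = 0.
Proof. by move: (valP a); rewrite inE => -[+ _] => /(_ t). Qed.

Lemma l2_eq a b : (forall t, A t -> a t = b t) -> a = b.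
Proof.
move=> ab; apply/val_inj/funext => t.
by have [/ab//|At] := pselect (A t); rewrite /= !l2_out.
Qed.

Lemma l2_sum_val I (s : seq I) (P : pred I) (F : I -> l2 R A) t :
  (\sum_(i <- s | P i) F i) t = \sum_(i <- s | P i) F i t.
Proof. exact: (big_morph (fun a : l2 R A => a t)). Qed.

Lemma esum_sqnorm_ge0 (f : T -> R[i]) (B : set T) :
  (0 <= \esum_(t in B) (sqnorm (f t))%:E)%E.
Proof. by apply: esum_ge0 => t _; rewrite lee_fin sqnorm_ge0. Qed.

(** By Pythagoras the squared norm of the remainder is the total mass minus the mass on [J]. The sum
    being a supremum, some finite set carries all but [e ^+ 2] of the mass. *)
Lemma l2_is_l2sum (c : T -> R[i]) a : (forall t, A t -> a t = c t) -> is_l2sum c a.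
Proof.
move=> ac e e0.
pose f t := (sqnorm (a t))%:E.
have f0 t : (0 <= f t)%E by rewrite lee_fin sqnorm_ge0.
have fS : \esum_(t in A) f t = (l2norm a ^+ 2)%:E by rewrite l2norm_sqr.
have [|x [F [finF FA] <-]] := @ub_ereal_sup_adherent _
    [set \sum_(x \in F) f x | F in fsets A]%E (e ^+ 2) (exprn_gt0 _ e0).
  by have := fS; rewrite /esum => ->.
rewrite -/(esum A f) fS => FS.
have FE : [set` fset_set F] = F by rewrite fset_setK.
exists (fset_set F) => [|J JF JA]; first by rewrite FE.
set b := a - _.
have bE t : A t -> b t = if t \in J then 0 else a t.
  move=> At; rewrite -[b t]/(a t - (\sum_(t <- J) c t *: zeta R A t) t).
  rewrite l2_sum_val; case: ifPn => tJ.
    rewrite (big_fsetD1 t)//= [in X in _ - X]big1_fset ?addr0; last first.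
      move=> i; rewrite !inE => /andP[it iJ] _.
      rewrite -[LHS]/(c i * zeta R A i t) zetaE eq_sym (negbTE it) andbF.
      by rewrite mulr0.
    rewrite -[X in _ - X]/(c t * zeta R A t t) zetaE eqxx asboolT//=.
    by rewrite mulr1 ac// subrr.
  rewrite big1_fset ?subr0// => i iJ _.
  rewrite -[LHS]/(c i * zeta R A i t) zetaE.
  by case: eqP => [ti|]; [rewrite ti iJ in tJ|rewrite andbF mulr0].
clearbody b.
have SE : (l2norm a ^+ 2)%:E =
    ((l2norm b ^+ 2)%:E + \esum_(t in A `&` [set` J]) f t)%E.
  rewrite -fS (esumID [set` J])// addeC; congr (_ + _)%E.
  rewrite l2norm_sqr [RHS](esumID [set` J]); last first.
    by move=> t _; rewrite lee_fin sqnorm_ge0.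
  rewrite [X in _ = (X + _)%E]esum1 ?add0e.
    apply: eq_esum => t [At tJ] /=; rewrite bE// ifN//.
    by apply/negP.
  by move=> t [At /= tJ] /=; rewrite bE// tJ sqnorm0.
have FJ : (\sum_(x \in F) f x <= \esum_(t in A `&` [set` J]) f t)%E.
  apply: esum_ge; exists F => //; split=> // t Ft; split; first exact: FA.
  by apply: JF; rewrite FE.
have : ((l2norm b ^+ 2)%:E < (e ^+ 2)%:E)%E.
  move: (lt_le_trans FS FJ) SE.
  case: (esum _ f) (esum_sqnorm_ge0 a (A `&` [set` J])) => [y _| |]//.
  rewrite -EFinB lte_fin -EFinD => Sy [bS]; rewrite lte_fin; lra.
by rewrite lte_fin ltr_pXn2r// nnegrE ?sqrtr_ge0// ltW.
Qed.

End l2_families.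

(** * Measurability of the groupoid operations *)

Section measurable_structure.
Context (R : realType) (d0 d : measure_display).
Context (G0 : measurableType d0) (G : measurableType d).
Variable Gd : discrete_measured_groupoid R G0 G.
Notation gsrc := (gsrc Gd).
Notation grng := (grng Gd).
Notation gid := (gid Gd).
Notation gcomp := (gcomp Gd).
Notation ginv := (ginv Gd).
Implicit Types phi : edge Gd.

Lemma ginvK : involutive ginv.
Proof.
move=> g; rewrite -[LHS](gcomp1l Gd) gsrc_inv grng_inv -(gcompV Gd g).
rewrite -gcompA ?gsrc_inv ?grng_inv// (gcompV Gd (ginv g)) gsrc_inv.
exact: gcomp1r.
Qed.

(** [measurable_gid] tests a set of objects on its image under [gid], and the image of the preimage
    of [B] is the part of [B] inside the units. *)
Lemma measurable_gid_fun : measurable_fun setT gid.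
Proof.
move=> _ B mB; rewrite setTI; apply/(measurable_gid Gd).
rewrite (_ : _ @` _ = B `&` range gid).
  by apply: measurableI => //; exact/(measurable_gid Gd).
by apply/seteqP; split=> [_ [x Bx <-]|g [Bg [x _ xg]]];
  [split=> //; exists x|exists x => //=; rewrite xg].
Qed.

Lemma eimgP phi g : eimg phi g <-> edom phi (gsrc g) /\ phi (gsrc g) = g.
Proof.
by split=> [[x px <-]|[]]; [rewrite gsrc_efun|exists (gsrc g)].
Qed.

(* Any measurable total section of the source map extending [phi] off its
   domain would do; [gid] never meets [eimg phi] there. *)
Definition etot phi x : G := if `[< edom phi x >] then phi x else gid x.

Lemma gsrc_etot phi x : gsrc (etot phi x) = x.
Proof. by rewrite /etot; case: asboolP => [/gsrc_efun//|_]; exact: gsrc_id. Qed.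

Lemma eimg_etot phi x : eimg phi (etot phi x) <-> edom phi x.
Proof.
split=> [/eimgP|px]; rewrite /etot; case: asboolP => //.
  by move=> _ []; rewrite gsrc_id.
by exists x.
Qed.

Lemma measurable_asbool d' (S : measurableType d') (A : set S) : measurable A ->
  measurable_fun setT (fun x => `[< A x >]).
Proof.
move=> mA; apply: (measurable_fun_bool true).
rewrite setTI (_ : _ @^-1` _ = A)//.
by apply/seteqP; split=> x /= /asboolP.
Qed.

Lemma measurable_if_asbool d' d'' (S : measurableType d') (S' : measurableType d'')
    (A : set S) (f g : S -> S') : measurable A ->
  measurable_fun A f -> measurable_fun setT g ->
  measurable_fun setT (fun x => if `[< A x >] then f x else g x).
Proof.
move=> mA mf mg; apply: measurable_fun_if => //; first exact: measurable_asbool.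
  apply: measurable_funS mf => // x [_] /=; exact: asboolW.
exact: measurable_funS mg.
Qed.

Lemma measurable_etot phi : measurable_fun setT (etot phi).
Proof.
apply: measurable_if_asbool; [exact: measurable_edom|exact: measurable_efun|].
exact: measurable_gid_fun.
Qed.

(** Above [edom phi] the image is the fixed locus of [etot phi \o gsrc], an equalizer of measurable
    maps into a standard Borel space. *)
Lemma measurable_eimg phi : measurable (eimg phi).
Proof.
rewrite (_ : eimg phi = [set g | etot phi (gsrc g) = g] `&`
    gsrc @^-1` edom phi).
  apply: measurableI.
    apply: (measurable_eq_fun (borel_mor Gd)); last exact: measurable_id.
    by apply: measurableT_comp; [exact: measurable_etot|exact: measurable_gsrc].
  rewrite -[X in measurable X]setTI; apply: measurable_gsrc => //.
  exact: measurable_edom.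
apply/seteqP; split=> g; rewrite /= eimgP /etot.
  by move=> [pg pgE]; rewrite asboolT.
by move=> [] /[swap] pg; rewrite asboolT.
Qed.

Variable psi : edge_partition Gd.

Lemma epart_exists g : exists j, eimg (psi j) g.
Proof.
have : (\bigcup_j eimg (psi j)) g by rewrite epart_cover.
by move=> [j _]; exists j.
Qed.

(* Describing the domain of the inverse edge through the countable partition
   [psi] makes it measurable without the Lusin-Souslin theorem on injective
   images of Borel sets. *)
Lemma einv_domP phi y : einv_dom phi y <->
  exists j, edom (psi j) y /\ eimg phi (ginv (psi j y)).
Proof.
split=> [[_ [x px <-] <-]|[j [py]]].
  have [j] := epart_exists (ginv (phi x)).
  move=> /eimgP; rewrite gsrc_inv => -[pj pjE]; exists j; split=> //.
  by rewrite pjE ginvK; exists x.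
move=> [x px xE]; exists (phi x); first by exists x.
by rewrite xE grng_inv gsrc_efun.
Qed.

Lemma einv_eimg phi g : eimg phi (ginv g) -> einv phi (gsrc g) = g.
Proof.
move=> [x px xg]; have -> : gsrc g = grng (phi x) by rewrite xg grng_inv.
by rewrite einvE// xg ginvK.
Qed.

Lemma gsrc_einv phi y : einv_dom phi y -> gsrc (einv phi y) = y.
Proof. by move=> [_ [x px <-] <-]; rewrite einvE// gsrc_inv. Qed.

Lemma measurable_einv_piece phi (B : set G) : measurable B -> measurable
  (\bigcup_j (edom (psi j) `&` etot (psi j) @^-1` (ginv @^-1` eimg phi `&` B))).
Proof.
move=> mB; apply: bigcup_measurable => j _.
apply: measurableI; first exact: measurable_edom.
rewrite -[X in measurable X]setTI; apply: measurable_etot => //.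
apply: measurableI => //.
by rewrite -[X in measurable X]setTI; apply: measurable_ginv => //;
  exact: measurable_eimg.
Qed.

(** On the j-th piece [einv phi] coincides with [psi j]: by [einv_eimg], an arrow whose inverse lies
    in [eimg phi] is the value of the inverse edge at its source. *)
Lemma einv_preimage phi (B : set G) : einv_dom phi `&` einv phi @^-1` B =
  \bigcup_j (edom (psi j) `&` etot (psi j) @^-1` (ginv @^-1` eimg phi `&` B)).
Proof.
apply/seteqP; split=> y.
  move=> [/einv_domP[j [pj pE]]] /=.
  rewrite -{1}(gsrc_efun pj) (einv_eimg pE) => By.
  by exists j => //; split; rewrite //= /etot asboolT.
move=> [j _ [pj]]; rewrite /= /etot asboolT// => -[pE By].
split; first by apply/einv_domP; exists j.
by rewrite /= -(gsrc_efun pj) (einv_eimg pE).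
Qed.

Lemma measurable_einv_dom phi : measurable (einv_dom phi).
Proof.
rewrite -(setIT (einv_dom phi)) -(preimage_setT (einv phi)) einv_preimage.
exact: measurable_einv_piece.
Qed.

Lemma measurable_einv phi : measurable_fun (einv_dom phi) (einv phi).
Proof. by move=> _ B mB; rewrite einv_preimage; exact: measurable_einv_piece. Qed.

(** The point map behind [edge_act]. By [eshift_inv] and [eshiftK] it is a bijection from the arrows
    ending in [einv_dom phi] onto those ending in [edom phi], inverse to right translation by
    [phi]. *)
Definition eshift phi g : G := gcomp g (einv phi (grng g)).

Lemma gsrc_eshift phi g : einv_dom phi (grng g) -> gsrc (eshift phi g) = gsrc g.
Proof. by move=> pg; rewrite gsrc_comp// gsrc_einv. Qed.

Lemma eshift_inv phi g : einv_dom phi (grng g) ->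
  edom phi (grng (eshift phi g)) /\
  gcomp (eshift phi g) (phi (grng (eshift phi g))) = g.
Proof.
move=> [_ [x px <-] xg]; rewrite /eshift -xg einvE//.
have gx : grng g = gsrc (ginv (phi x)) by rewrite gsrc_inv xg.
rewrite grng_comp// grng_inv gsrc_efun//; split=> //.
by rewrite -gcompA ?grng_inv// gcompVl xg gcomp1r.
Qed.

Lemma eshiftK phi k : edom phi (grng k) ->
  einv_dom phi (grng (gcomp k (phi (grng k)))) /\
  eshift phi (gcomp k (phi (grng k))) = k.
Proof.
move=> pk; rewrite /eshift grng_comp ?gsrc_efun//; split.
  by exists (phi (grng k)) => //; exists (grng k).
by rewrite einvE// -gcompA ?gsrc_inv ?gsrc_efun// gcompV gsrc_efun// gcomp1r.
Qed.

Lemma measurable_eshift phi : measurable_fun (grng @^-1` einv_dom phi) (eshift phi).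
Proof.
have mD : measurable (grng @^-1` einv_dom phi).
  rewrite -[X in measurable X]setTI; apply: measurable_grng => //.
  exact: measurable_einv_dom.
(* Composition is measurable only on composable pairs; completing the second component by identities
   makes [h] a total measurable map that stays inside the composable pairs on the domain of
   interest. *)
pose h g := (g, if `[< (grng @^-1` einv_dom phi) g >] then einv phi (grng g)
  else gid (grng g)).
have mh : measurable_fun setT h.
  apply: measurable_fun_pair; first exact: measurable_id.
  apply: measurable_if_asbool => //.
    apply: (measurable_comp (measurable_einv_dom phi)) => //.
    - by move=> _ [g pg <-].
    - exact: measurable_einv.
    - by apply: measurable_funTS; exact: measurable_grng.
  by apply: measurableT_comp; [exact: measurable_gid_fun|exact: measurable_grng].
apply: (eq_measurable_fun ((fun p => gcomp p.1 p.2) \o h)).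
  by move=> g; rewrite inE => pg; rewrite /h /= asboolT.
apply: (measurable_comp _ _ (@measurable_gcomp _ _ _ _ _ Gd)).
- apply: (measurable_eq_fun (borel_obj Gd)); apply: measurableT_comp => //.
  + exact: measurable_grng.
  + exact: measurable_gsrc.
- by move=> _ [g pg <-]; rewrite /h /= asboolT// gsrc_einv.
- exact: measurable_funTS.
Qed.

Lemma measurable_edge_act phi (F : G -> R[i]) : cmeasurable F ->
  cmeasurable (edge_act phi F).
Proof.
have mD : measurable (grng @^-1` einv_dom phi).
  rewrite -[X in measurable X]setTI; apply: measurable_grng => //.
  exact: measurable_einv_dom.
move=> [mF mF']; split.
  rewrite (_ : (fun _ => _) = fun g =>
      if `[< (grng @^-1` einv_dom phi) g >] then Re (F (eshift phi g)) else 0).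
    apply: measurable_if_asbool => //.
    exact: (measurableT_comp mF (@measurable_eshift phi)).
  by apply/funext => g; rewrite /edge_act /=; case: asboolP.
rewrite (_ : (fun _ => _) = fun g =>
    if `[< (grng @^-1` einv_dom phi) g >] then Im (F (eshift phi g)) else 0).
  apply: measurable_if_asbool => //.
  exact: (measurableT_comp mF' (@measurable_eshift phi)).
by apply/funext => g; rewrite /edge_act /=; case: asboolP.
Qed.

Lemma measurable_mult_act (f : G0 -> R[i]) (F : G -> R[i]) :
  cmeasurable f -> cmeasurable F -> cmeasurable (mult_act Gd f F).
Proof.
move=> [mf mf'] [mF mF'].
have mr : measurable_fun setT (fun g => Re (f (grng g))).
  exact: (measurableT_comp mf (measurable_grng Gd)).
have mr' : measurable_fun setT (fun g => Im (f (grng g))).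
  exact: (measurableT_comp mf' (measurable_grng Gd)).
split.
  rewrite (_ : (fun _ => _) = fun g =>
      Re (f (grng g)) * Re (F g) - Im (f (grng g)) * Im (F g)).
    by apply: measurable_funB; exact: measurable_funM.
  by apply/funext => g; rewrite /mult_act; case: (f _) (F g) => ? ? [].
rewrite (_ : (fun _ => _) = fun g =>
    Re (f (grng g)) * Im (F g) + Im (f (grng g)) * Re (F g)).
  by apply: measurable_funD; exact: measurable_funM.
by apply/funext => g; rewrite /mult_act; case: (f _) (F g) => ? ? [].
Qed.

End measurable_structure.

(** * Integration along the fibres *)

Section integration.
Context (R : realType) (d0 d : measure_display).
Context (G0 : measurableType d0) (G : measurableType d).
Variable Gd : discrete_measured_groupoid R G0 G.
Notation mu0 := (obj_measure Gd).
Notation mu := (mor_measure Gd).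
Notation gsrc := (gsrc Gd).
Notation grng := (grng Gd).
Notation ginv := (ginv Gd).
Notation fiber := (fiber Gd).
Implicit Types phi : edge Gd.
Variable psi : edge_partition Gd.

Lemma counting_set1 (g : G) : @counting G R [set g] = 1%E.
Proof. by rewrite /counting asboolT// fset_set1 cardfs1. Qed.

(** For sets that meet each fibre at most once, this turns the counting integrands in the two
    formulas for [mor_measure] into indicators on the objects. *)
Lemma counting_single (U : set G) (E : set G0) x g :
  (forall h, U h <-> h = g /\ E x) -> counting U = ((\1_E x)%:E : \bar R).
Proof.
move=> UE; rewrite indicE; have [Ex|Ex] := pselect (E x).
  rewrite mem_set// (_ : U = [set g]) ?counting_set1//.
  by apply/seteqP; split=> h /=; [move/UE => []|move=> ->; exact/UE].
rewrite memNset// (_ : U = set0) ?measure0//.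
by apply/seteqP; split=> h // /UE[].
Qed.

(** Each [eimg (psi j)] meets a fibre in one point or not at all, so the partition enumerates all
    fibres at once. Fibre sums become series of measurable functions of [x], open to monotone
    convergence. *)
Lemma esum_fiber (H : G -> \bar R) x : (forall g, 0 <= H g)%E ->
  \esum_(g in fiber x) H g =
  (\sum_(0 <= j <oo) (if `[< edom (psi j) x >] then H (etot (psi j) x) else 0))%E.
Proof.
move=> H0; pose J j := eimg (psi j) `&` fiber x.
have {1}-> : fiber x = \bigcup_j J j by rewrite -setI_bigcupl epart_cover setTI.
have tJ : trivIset setT J by apply: trivIset_setIr; exact: epart_disj.
rewrite (esum_bigcupT _ _ tJ)// nneseries_esumT; last by move=> j; case: ifP.
apply: eq_esum => j _; rewrite /etot; case: asboolP => px.
  rewrite (_ : J j = [set psi j x]) ?esum_set1//.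
  apply/seteqP; split=> [_ [[y py <-]]|_ ->]; rewrite /J /Defs.fiber /=.
    by rewrite gsrc_efun// => <-.
  by split; [exists x|exact: gsrc_efun].
rewrite (_ : J j = set0) ?esum_set0//.
apply/seteqP; split=> // _ [[y py <-]]; rewrite /Defs.fiber /= gsrc_efun// => yx.
by rewrite yx in py.
Qed.

Lemma measurable_esum_fiber (H : G -> \bar R) : measurable_fun setT H ->
  (forall g, 0 <= H g)%E ->
  measurable_fun setT (fun x => \esum_(g in fiber x) H g).
Proof.
move=> mH H0; under eq_fun do rewrite esum_fiber//.
apply: ge0_emeasurable_sum => [j x _ _|j _]; first by case: ifP.
apply: measurable_if_asbool => //; first exact: measurable_edom.
by apply: measurable_funTS; apply: measurableT_comp => //; exact: measurable_etot.
Qed.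

(** A source fibre meets [eimg phi] at most once, so on subsets of [eimg phi] the measure [mu] is
    the image of [mu0] under [etot phi], and the change of variables formula applies. *)
Lemma ge0_integral_eimg phi (H : G -> \bar R) : measurable_fun setT H ->
  (forall g, 0 <= H g)%E ->
  (\int[mu]_(g in eimg phi) H g = \int[mu0]_(x in edom phi) H (etot phi x))%E.
Proof.
move=> mH H0; have mphi := measurable_etot phi.
have mimg := measurable_eimg phi.
transitivity (\int[pushforward mu0 (etot phi)]_(g in eimg phi) H g)%E.
  apply: eq_measure_integral => A mA Aphi; rewrite mor_measure_gsrc//.
  rewrite (eq_integral (fun x => (\1_(etot phi @^-1` A) x)%:E)); last first.
    move=> x _; apply: (@counting_single _ _ _ (etot phi x)) => h.
    split=> [[hx Ah]|[-> /= pA]]; last first.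
      by split=> //; exact: gsrc_etot.
    have /eimgP[ph phE] := Aphi _ Ah.
    have eh : etot phi x = h by rewrite /etot -hx asboolT.
    by rewrite /preimage/= eh.
  rewrite integral_indic ?setIT// -[X in measurable X]setTI.
  exact: mphi.
rewrite ge0_integral_pushforward//; last exact: measurable_funTS.
rewrite (_ : _ @^-1` _ = edom phi)//.
by apply/seteqP; split=> x /= /eimg_etot.
Qed.

(** Both sides split into series over the partition, and [ge0_integral_eimg] matches them term by
    term. *)
Lemma ge0_integral_fiber (H : G -> \bar R) : measurable_fun setT H ->
  (forall g, 0 <= H g)%E ->
  (\int[mu]_g H g = \int[mu0]_x \esum_(g in fiber x) H g)%E.
Proof.
move=> mH H0; under [RHS]eq_integral do rewrite esum_fiber//.
rewrite integral_nneseries//; last 2 first.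
- move=> j; apply: measurable_if_asbool => //; first exact: measurable_edom.
  by apply: measurable_funTS; apply: measurableT_comp => //; exact: measurable_etot.
- by move=> j x _; case: ifP.
rewrite -(epart_cover psi) ge0_integral_bigcup//; last 3 first.
- by move=> j; exact: measurable_eimg.
- exact: measurable_funTS.
- exact: epart_disj.
apply: eq_eseriesr => j _; rewrite ge0_integral_eimg// [LHS]integral_mkcond.
apply: eq_integral => x _; rewrite patchE.
by case: asboolP => px; [rewrite mem_set|rewrite memNset].
Qed.

(** The indicator of a null set has integral zero, so its fibre sums vanish for almost every [x]:
    almost every fibre avoids the set. Conversely, arrows with source in a null set have fibre sums
    vanishing almost everywhere, hence form a null set. *)
Lemma ae_fiber (P : G -> Prop) : {ae mu, forall g, P g} <->
  {ae mu0, forall x, forall g, fiber x g -> P g}.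
Proof.
split=> [[N [mN N0 PN]]|[N [mN N0 PN]]].
  have mI : measurable_fun setT (fun g => (\1_N g)%:E : \bar R).
    exact/measurable_EFinP/measurable_indic.
  have I0 g : (0 <= (\1_N g)%:E :> \bar R)%E by rewrite lee_fin.
  have : (\int[mu]_g (\1_N g)%:E = 0)%E by rewrite integral_indic// setIT.
  rewrite ge0_integral_fiber// => IN.
  have [+ _] := ae_eq_integral_abs mu0 measurableT (measurable_esum_fiber mI I0).
  have -> : (\int[mu0]_x `|\esum_(g in fiber x) (\1_N g)%:E| = 0)%E.
    rewrite -[RHS]IN; apply: eq_integral => x _; rewrite gee0_abs//.
    exact: esum_ge0.
  move=> /(_ erefl).
  apply: filterS => x /(_ I) xN g xg; apply: contrapT => /PN Ng.
  have : ((\1_N g)%:E <= \esum_(g in fiber x) (\1_N g)%:E :> \bar R)%E.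
    apply: esum_ge; exists [set g]; last by rewrite fsbig_set1.
    by split=> // _ ->.
  by rewrite xN indicE mem_set// lee_fin ler10.
have mN' : measurable (gsrc @^-1` N).
  by rewrite -[X in measurable X]setTI; exact: measurable_gsrc.
exists (gsrc @^-1` N); split => //; last first.
  by move=> g /= Pg; apply: PN => gP; exact: (Pg (gP g erefl)).
have mI : measurable_fun setT (fun g => (\1_(gsrc @^-1` N) g)%:E : \bar R).
  exact/measurable_EFinP/measurable_indic.
rewrite -(setIT (gsrc @^-1` N)) -integral_indic// ge0_integral_fiber//.
rewrite (ge0_ae_eq_integral (g := cst 0%E)) ?integral0//.
- exact: measurable_esum_fiber.
- by move=> x _; apply: esum_ge0 => g _; rewrite lee_fin.
exists N; split=> // x /= xN; apply: contrapT => Nx; apply: xN => _.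
by apply: esum1 => g xg; rewrite indicE memNset//= xg.
Qed.

(** The arrows ending in a null set are cut into countably many pieces whose inverses lie in one
    [eimg (psi j)]. Such a piece has at most one arrow for each range, so the formula over range
    fibres bounds its measure by that of the null set. *)
Lemma ae_grng (P : G0 -> Prop) : {ae mu0, forall x, P x} ->
  {ae mu, forall g, P (grng g)}.
Proof.
move=> [N [mN N0 PN]].
pose V j := grng @^-1` N `&` ginv @^-1` eimg (psi j).
have mV j : measurable (V j).
  apply: measurableI; rewrite -[X in measurable X]setTI.
    exact: measurable_grng.
  by apply: measurable_ginv => //; exact: measurable_eimg.
suff : mu.-negligible (~` [set g | P (grng g)]) by [].
apply: (@negligibleS _ _ _ mu (\bigcup_j V j)).
  move=> g /= Pg; have [j gj] := epart_exists psi (ginv g).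
  by exists j => //; split => //=; exact: PN.
apply: negligible_bigcup => j; apply/negligibleP => //.
suff : mu (V j) = 0%E by [].
rewrite mor_measure_grng//.
rewrite (eq_integral (fun x => (\1_(N `&` edom (psi j)) x)%:E)); last first.
  move=> x _; apply: (@counting_single _ _ _ (ginv (psi j x))) => h.
  split=> [[<- [Nh /eimgP[]]]|[-> [Nx px]]].
    by rewrite gsrc_inv => ph phE; rewrite phE ginvK.
  split; first by rewrite /= grng_inv gsrc_efun.
  by split; rewrite /= ?grng_inv ?gsrc_efun// ginvK; exists x.
rewrite integral_indic ?setIT//; last first.
  by apply: measurableI => //; exact: measurable_edom.
apply: (subset_measure0 _ _ _ N0) => //.
by apply: measurableI => //; exact: measurable_edom.
Qed.

End integration.

(** * Signed and complex integrals along the fibres *)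

Section fiber_sums.
Context (R : realType) (d0 d : measure_display).
Context (G0 : measurableType d0) (G : measurableType d).
Variable Gd : discrete_measured_groupoid R G0 G.
Notation mu0 := (obj_measure Gd).
Notation mu := (mor_measure Gd).
Notation fiber := (fiber Gd).
Variable psi : edge_partition Gd.

Lemma measurable_rsum_fiber (h : G -> R) : measurable_fun setT h ->
  measurable_fun setT (fun x => rsum (fiber x) h).
Proof.
move=> /measurable_EFinP mh.
by apply: measurable_funB; apply: (measurableT_comp (@fine_measurable R setT _));
  rewrite //; apply: (measurable_esum_fiber psi);
  by [exact: measurable_funepos|exact: measurable_funeneg|
      move=> g; exact: funepos_ge0|move=> g; exact: funeneg_ge0].
Qed.

Lemma Rintegral_fiber (h : G -> R) : mu.-integrable setT (EFin \o h) ->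
  \int[mu]_g h g = \int[mu0]_x rsum (fiber x) h.
Proof.
move=> ih; have mh := measurable_int _ ih.
have mp := measurable_funepos mh; have mn := measurable_funeneg mh.
pose p x := (\esum_(g in fiber x) (EFin \o h)^\+ g)%E.
pose n x := (\esum_(g in fiber x) (EFin \o h)^\- g)%E.
have mP : measurable_fun setT p.
  by apply: (measurable_esum_fiber psi mp) => g; exact: funepos_ge0.
have mN : measurable_fun setT n.
  by apply: (measurable_esum_fiber psi mn) => g; exact: funeneg_ge0.
have p0 x : (0 <= p x)%E by apply: esum_ge0 => g _; exact: funepos_ge0.
have n0 x : (0 <= n x)%E by apply: esum_ge0 => g _; exact: funeneg_ge0.
have Ip : (\int[mu]_g (EFin \o h)^\+ g = \int[mu0]_x p x)%E.
  by apply: (ge0_integral_fiber psi mp) => g; exact: funepos_ge0.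
have In : (\int[mu]_g (EFin \o h)^\- g = \int[mu0]_x n x)%E.
  by apply: (ge0_integral_fiber psi mn) => g; exact: funeneg_ge0.
have ip : mu0.-integrable setT p.
  apply/integrableP; split => //; under eq_integral do rewrite gee0_abs//.
  by rewrite -Ip; exact: integral_funepos_lt_pinfty.
have in_ : mu0.-integrable setT n.
  apply/integrableP; split => //; under eq_integral do rewrite gee0_abs//.
  by rewrite -In; exact: integral_funeneg_lt_pinfty.
rewrite /Rintegral integralE Ip In -integralB//; congr fine.
apply: ae_eq_integral => //.
- by apply: emeasurable_funB.
- apply/measurable_EFinP; apply: measurable_rsum_fiber.
  exact/measurable_EFinP.
(* Both fibre sums are finite almost everywhere, so the [fine] in [rsum] loses nothing there. *)
apply: filterS2 (integrable_ae measurableT ip) (integrable_ae measurableT in_).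
by move=> x /(_ I) px /(_ I) nx _; rewrite /rsum EFinB !fineK.
Qed.

Lemma cmeasurable_mul_conj d' (T : measurableType d') (F F' : T -> R[i]) :
  cmeasurable F -> cmeasurable F' ->
  cmeasurable (fun g => F g * (F' g)^*)%C.
Proof.
move=> [mF mF'] [mH mH']; split.
  rewrite (_ : (fun _ => _) = fun g => Re (F g) * Re (F' g) + Im (F g) * Im (F' g)).
    by apply: measurable_funD; exact: measurable_funM.
  by apply/funext => g; case: (F g) (F' g) => ? ? [? ?] /=; rewrite mulrN opprK.
rewrite (_ : (fun _ => _) = fun g => Im (F g) * Re (F' g) - Re (F g) * Im (F' g)).
  by apply: measurable_funB; exact: measurable_funM.
by apply/funext => g; case: (F g) (F' g) => ? ? [? ?] /=; rewrite mulrN addrC.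
Qed.

Lemma norm_dot2_le (a b p q : R) :
  `|a * p + b * q| <= a ^+ 2 + b ^+ 2 + (p ^+ 2 + q ^+ 2).
Proof.
have h (c e : R) : `|c * e| <= c ^+ 2 + e ^+ 2.
  rewrite normrM -(real_normK (num_real c)) -(real_normK (num_real e)).
  rewrite -subr_ge0 (_ : _ - _ = (`|c| - `|e|) ^+ 2 + `|c| * `|e|); last by ring.
  by rewrite addr_ge0 ?sqr_ge0// mulr_ge0.
rewrite (le_trans (ler_normD _ _))// (le_trans (lerD (h _ _) (h _ _)))//.
by rewrite addrACA.
Qed.

(** Provides the integrable dominating function for the integrand of an inner product. *)
Lemma Re_Im_mul_conj_le (z w : R[i]) :
  `|Re (z * w^*)%C| <= sqnorm z + sqnorm w /\
  `|Im (z * w^*)%C| <= sqnorm z + sqnorm w.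
Proof.
case: z w => [a b] [p q]; rewrite /sqnorm/=; split.
  by rewrite mulrN opprK norm_dot2_le.
by rewrite mulrN addrC -mulNr -(sqrrN a) (addrC (_ ^+ 2)) norm_dot2_le.
Qed.

Lemma cintegral_fiber (F F' : G -> R[i]) : F \in sqint mu -> F' \in sqint mu ->
  cintegral mu (fun g => F g * (F' g)^*)%C =
  cintegral mu0 (fun x => csum (fiber x) (fun g => F g * (F' g)^*)%C).
Proof.
move=> /sqintP[mF IF] /sqintP[mF' IF'].
have [mr mi] := cmeasurable_mul_conj mF mF'.
have ms : measurable_fun setT (fun g => (sqnorm (F g))%:E + (sqnorm (F' g))%:E)%E.
  by apply: emeasurable_funD; exact: measurable_sqnorm.
have isum : mu.-integrable setT (fun g => (sqnorm (F g))%:E + (sqnorm (F' g))%:E)%E.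
  apply/integrableP; split => //.
  under eq_integral do rewrite gee0_abs ?adde_ge0 ?lee_fin ?sqnorm_ge0//.
  rewrite ge0_integralD//; first exact: lte_add_pinfty.
  - by move=> g _; rewrite lee_fin sqnorm_ge0.
  - exact: measurable_sqnorm.
  - by move=> g _; rewrite lee_fin sqnorm_ge0.
  - exact: measurable_sqnorm.
rewrite /cintegral !Rintegral_fiber//.
- apply: le_integrable isum => //; first exact/measurable_EFinP.
  move=> g _; rewrite /= lee_fin [leRHS]ger0_norm 1?addr_ge0 ?sqnorm_ge0//.
  exact: (Re_Im_mul_conj_le _ _).2.
- apply: le_integrable isum => //; first exact/measurable_EFinP.
  move=> g _; rewrite /= lee_fin [leRHS]ger0_norm 1?addr_ge0 ?sqnorm_ge0//.
  exact: (Re_Im_mul_conj_le _ _).1.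
Qed.

End fiber_sums.

(** * Sections of the field of fibres versus functions on the groupoid *)

Section sections.
Context (R : realType) (d0 d : measure_display).
Context (G0 : measurableType d0) (G : measurableType d).
Variable Gd : discrete_measured_groupoid R G0 G.
Notation mu0 := (obj_measure Gd).
Notation mu := (mor_measure Gd).
Notation gsrc := (gsrc Gd).
Notation fiber := (fiber Gd).
Implicit Types (xi eta : hsection Gd) (F : G -> R[i]).

Definition unsec xi : G -> R[i] := fun g => xi (gsrc g) g.

(* Takes the junk value [0] where [F] is not square-summable on the fibre. *)
Definition sec F : hsection Gd := fun x =>
  insubd (0 : l2 R (fiber x)) (fun g => if `[< fiber x g >] then F g else 0).

Lemma unsecE xi x g : fiber x g -> unsec xi g = xi x g.
Proof. by move=> <-. Qed.

Definition summable_on F : set G0 :=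
  [set x | (\esum_(g in fiber x) (sqnorm (F g))%:E < +oo)%E].

Lemma secE F x g : summable_on F x -> fiber x g -> sec F x g = F g.
Proof.
move=> Fx xg; rewrite /sec /= insubdK ?asboolT// inE; split.
  by move=> h xh; rewrite asboolF.
by rewrite (eq_esum (b := fun g => (sqnorm (F g))%:E))// => h xh; rewrite asboolT.
Qed.

Lemma sec_eq F F' x : (forall g, fiber x g -> F g = F' g) -> sec F x = sec F' x.
Proof.
move=> FF'; rewrite /sec; congr insubd; apply/funext => g.
by case: asboolP => // /FF'.
Qed.

Lemma sec_junk F x : ~ summable_on F x -> sec F x = 0.
Proof.
move=> Fx; rewrite /sec /insubd insubN//; apply/negP; rewrite inE => -[_ Fx'].
apply: Fx; rewrite /summable_on/=.
rewrite (eq_esum (b := fun g =>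
  (sqnorm (if `[< fiber x g >] then F g else 0))%:E))// => h xh.
by rewrite asboolT.
Qed.

(** Unlike [secK] this holds at every point: the values of a section are square-summable by type, so
    the junk value of [sec] does not occur. *)
Lemma unsecK xi : sec (unsec xi) = xi.
Proof.
apply: functional_extensionality_dep => x.
have xix : summable_on (unsec xi) x.
  rewrite /summable_on/= (eq_esum (b := fun g => (sqnorm (xi x g))%:E)).
    by rewrite -l2norm_sqr ltry.
  by move=> g xg; rewrite (unsecE _ xg).
by apply: l2_eq => g xg; rewrite secE// (unsecE _ xg).
Qed.

Variable psi : edge_partition Gd.

(** The inner products with the sections of [psi] are the values of [unsec xi] along the edges;
    conversely these values glue over the countably many measurable pieces [eimg (psi j)]. In
    particular measurability of a section does not depend on [psi]. *)
Lemma measurable_sectionP xi : measurable_section psi xi <-> cmeasurable (unsec xi).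
Proof.
split=> [mxi|[mxi mxi'] j]; last first.
  split.
    rewrite (_ : (fun _ => _) = fun x => if `[< edom (psi j) x >] then
        Re (unsec xi (etot (psi j) x)) else 0).
      apply: measurable_if_asbool => //; first exact: measurable_edom.
      apply: measurable_funTS; apply: (measurableT_comp mxi).
      exact: measurable_etot.
    apply/funext => x; rewrite l2inner_edge_section /etot; case: asboolP => // px.
    by rewrite (unsecE _ (gsrc_efun px)).
  rewrite (_ : (fun _ => _) = fun x => if `[< edom (psi j) x >] then
      Im (unsec xi (etot (psi j) x)) else 0).
    apply: measurable_if_asbool => //; first exact: measurable_edom.
    apply: measurable_funTS; apply: (measurableT_comp mxi').
    exact: measurable_etot.
  apply/funext => x; rewrite l2inner_edge_section /etot; case: asboolP => // px.
  by rewrite (unsecE _ (gsrc_efun px)).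
have pieceE j g : eimg (psi j) g ->
    l2inner (xi (gsrc g)) (edge_section (psi j) (gsrc g)) = unsec xi g.
  by move=> /eimgP[pg pgE]; rewrite l2inner_edge_section asboolT// pgE.
split; rewrite -(epart_cover psi); apply/measurable_fun_bigcup => j.
- exact: measurable_eimg.
- apply: (eq_measurable_fun (fun g =>
      Re (l2inner (xi (gsrc g)) (edge_section (psi j) (gsrc g))))).
    by move=> g; rewrite inE => /pieceE ->.
  apply: measurable_funTS.
  exact: (measurableT_comp (mxi j).1 (measurable_gsrc Gd)).
- exact: measurable_eimg.
- apply: (eq_measurable_fun (fun g =>
      Im (l2inner (xi (gsrc g)) (edge_section (psi j) (gsrc g))))).
    by move=> g; rewrite inE => /pieceE ->.
  apply: measurable_funTS.
  exact: (measurableT_comp (mxi j).2 (measurable_gsrc Gd)).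
Qed.

Lemma integral_sqnorm_unsec xi : cmeasurable (unsec xi) ->
  (\int[mu]_g (sqnorm (unsec xi g))%:E =
   \int[mu0]_x (l2norm (xi x) ^+ 2)%:E)%E.
Proof.
move=> mxi; rewrite (ge0_integral_fiber psi); last 2 first.
- exact: measurable_sqnorm.
- by move=> g; rewrite lee_fin sqnorm_ge0.
apply: eq_integral => x _; rewrite l2norm_sqr.
by apply: eq_esum => g xg; rewrite (unsecE _ xg).
Qed.

Lemma sqint_sectionP xi : xi \in sqint_section psi <-> unsec xi \in sqint mu.
Proof.
rewrite inE; split=> [[/measurable_sectionP mxi Ixi]|/sqintP[mxi Ixi]].
  by apply/sqintP; rewrite integral_sqnorm_unsec.
split; first exact/measurable_sectionP.
by rewrite -integral_sqnorm_unsec.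
Qed.

(** The fibre sums have finite integral, hence are finite almost everywhere. *)
Lemma ae_summable_on F : F \in sqint mu -> {ae mu0, forall x, summable_on F x}.
Proof.
move=> /sqintP[mF IF]; have ms := measurable_sqnorm mF.
have s0 g : (0 <= (sqnorm (F g))%:E)%E by rewrite lee_fin sqnorm_ge0.
have iF : mu0.-integrable setT (fun x => \esum_(g in fiber x) (sqnorm (F g))%:E)%E.
  apply/integrableP; split; first exact: (measurable_esum_fiber psi).
  under eq_integral do rewrite gee0_abs ?esum_sqnorm_ge0//.
  by rewrite -(ge0_integral_fiber psi).
apply: filterS (integrable_ae measurableT iF) => x /(_ I).
by rewrite ge0_fin_numE ?esum_sqnorm_ge0.
Qed.

Lemma secK F : F \in sqint mu -> {ae mu, forall g, unsec (sec F) g = F g}.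
Proof.
move=> sF; apply/(ae_fiber psi); apply: filterS (ae_summable_on sF) => x Fx g xg.
by rewrite (unsecE _ xg) secE.
Qed.

(** [sec] replaces [F] by zero above the objects with infinite fibre sum, and these form a
    measurable set. *)
Lemma cmeasurable_unsec_sec F : cmeasurable F -> cmeasurable (unsec (sec F)).
Proof.
move=> mF; have [mr mi] := mF.
have mS : measurable (gsrc @^-1` summable_on F).
  rewrite -[X in measurable X]setTI; apply: measurable_gsrc => //.
  rewrite (_ : summable_on F = ~` ((fun x =>
      \esum_(g in fiber x) (sqnorm (F g))%:E)%E @^-1` [set +oo%E])).
    apply: measurableC; rewrite -[X in measurable X]setTI.
    apply: (measurable_esum_fiber psi) => //; first exact: measurable_sqnorm.
    by move=> g; rewrite lee_fin sqnorm_ge0.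
  apply/seteqP; split=> x; rewrite /summable_on /=.
    by move=> + xy; rewrite xy.
  by rewrite ltey => /eqP.
have secF g : unsec (sec F) g = if `[< summable_on F (gsrc g) >] then F g else 0.
  by case: asboolP => [Fg|/sec_junk Fg]; rewrite /unsec ?Fg// secE.
split.
  rewrite (_ : (fun _ => _) = fun g =>
      if `[< (gsrc @^-1` summable_on F) g >] then Re (F g) else 0).
    by apply: measurable_if_asbool => //; exact: measurable_funTS.
  by apply/funext => g; rewrite secF; case: asboolP.
rewrite (_ : (fun _ => _) = fun g =>
    if `[< (gsrc @^-1` summable_on F) g >] then Im (F g) else 0).
  by apply: measurable_if_asbool => //; exact: measurable_funTS.
by apply/funext => g; rewrite secF; case: asboolP.
Qed.

Lemma sec_sqint F : F \in sqint mu -> sec F \in sqint_section psi.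
Proof.
move=> sF; have /sqintP[mF _] := sF; apply/sqint_sectionP.
apply: (sqint_ae_eq sF); first exact: cmeasurable_unsec_sec.
by apply: filterS (secK sF) => g ->.
Qed.

Lemma sec_lin k F F' : F \in sqint mu -> F' \in sqint mu ->
  {ae mu0, forall x, sec (k *: F + F') x = k *: sec F x + sec F' x}.
Proof.
move=> sF sF'; have sS : k *: F + F' \in sqint mu by rewrite rpredD// rpredZ.
apply: filterS3 (ae_summable_on sF) (ae_summable_on sF') (ae_summable_on sS).
move=> x Fx Fx' Sx; apply: l2_eq => g xg; rewrite secE//.
by rewrite -[RHS]/(k * sec F x g + sec F' x g) !secE.
Qed.

End sections.
Arguments sqint_sectionP {R d0 d G0 G Gd} psi xi.

(** * The unitary onto the direct integral *)

Section direct_integral.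
Context (R : realType) (d0 d : measure_display).
Context (G0 : measurableType d0) (G : measurableType d).
Variable Gd : discrete_measured_groupoid R G0 G.
Notation mu0 := (obj_measure Gd).
Notation mu := (mor_measure Gd).
Notation fiber := (fiber Gd).
Variable psi : edge_partition Gd.
Implicit Types (xi eta : hsection Gd) (F : G -> R[i]) (u : L2 mu) (v : dirint psi).

Lemma sqint_section_lin a xi eta : xi \in sqint_section psi ->
  eta \in sqint_section psi -> a *: xi + eta \in sqint_section psi.
Proof. exact: (sqint_section_submod_closed psi).2. Qed.

Lemma insubd_sectionK xi : xi \in sqint_section psi ->
  hsection_val (insubd (0 : sqint_hsection psi) xi) = xi.
Proof. exact: insubdK. Qed.

Lemma dirint_class_eqP xi eta :
  xi \in sqint_section psi -> eta \in sqint_section psi ->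
  dirint_class psi xi = dirint_class psi eta <->
  {ae mu0, forall x, xi x = eta x}.
Proof.
move=> /insubd_sectionK + /insubd_sectionK; rewrite /dirint_class.
set a := insubd _ xi; set b := insubd _ eta => aE bE.
have abE x : hsection_val (a - b) x = xi x - eta x.
  exact: (f_equal2 (fun xi eta : hsection Gd => xi x - eta x) aE bE).
split=> [/qclassP|xieta]; last apply/qclassP; rewrite inE.
  by apply: filterS => x; rewrite abE => /eqP; rewrite subr_eq0 => /eqP.
by apply: filterS xieta => x xieta; rewrite abE xieta subrr.
Qed.

Lemma dirint_repr_sqint v : dirint_repr v \in sqint_section psi.
Proof. exact: valP. Qed.

Lemma dirint_class_repr v : dirint_class psi (dirint_repr v) = v.
Proof. by rewrite /dirint_class /dirint_repr valKd qreprK. Qed.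

Lemma dirint_repr_class xi : xi \in sqint_section psi ->
  {ae mu0, forall x, dirint_repr (dirint_class psi xi) x = xi x}.
Proof.
move=> sxi; apply/(dirint_class_eqP (dirint_repr_sqint _) sxi).
exact: dirint_class_repr.
Qed.

Lemma dirint_class_lin a xi eta :
  xi \in sqint_section psi -> eta \in sqint_section psi ->
  dirint_class psi (a *: xi + eta) =
  a *: dirint_class psi xi + dirint_class psi eta.
Proof.
move=> sxi seta; rewrite /dirint_class -qclass_is_linear; congr qclass.
apply: val_inj; rewrite -[LHS]/(hsection_val _).
rewrite (insubd_sectionK (sqint_section_lin a sxi seta)).
by rewrite -{1}(insubd_sectionK sxi) -{1}(insubd_sectionK seta).
Qed.

Lemma eq_rsum (T : choiceType) (A : set T) (f g : T -> R) :
  (forall t, A t -> f t = g t) -> rsum A f = rsum A g.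
Proof.
move=> fg; rewrite /rsum; congr (fine _ - fine _); apply: eq_esum => t At.
  by rewrite !funeposE /= fg.
by rewrite !funenegE /= fg.
Qed.

Lemma l2inner_unsec xi eta x : l2inner (xi x) (eta x) =
  csum (fiber x) (fun g => unsec xi g * (unsec eta g)^*)%C.
Proof.
by congr Complex; apply: eq_rsum => g xg; rewrite !(unsecE _ xg).
Qed.

Lemma cmeasurable_l2inner xi eta :
  xi \in sqint_section psi -> eta \in sqint_section psi ->
  cmeasurable (fun x => l2inner (xi x) (eta x)).
Proof.
move=> /(sqint_sectionP psi)/sqintP[mxi _] /(sqint_sectionP psi)/sqintP[meta _].
under eq_fun do rewrite l2inner_unsec.
have [mr mi] := cmeasurable_mul_conj mxi meta.
by split; exact: (measurable_rsum_fiber psi).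
Qed.

Lemma dirint_inner_class xi eta :
  xi \in sqint_section psi -> eta \in sqint_section psi ->
  dirint_inner (dirint_class psi xi) (dirint_class psi eta) =
  cintegral mu0 (fun x => l2inner (xi x) (eta x)).
Proof.
move=> sxi seta; apply: cintegral_ae_eq.
- by apply: cmeasurable_l2inner; exact: dirint_repr_sqint.
- exact: cmeasurable_l2inner.
apply: filterS2 (dirint_repr_class sxi) (dirint_repr_class seta) => x e1 e2.
exact: (f_equal2 (@l2inner R G (fiber x)) e1 e2).
Qed.

Definition tosec u : dirint psi := dirint_class psi (sec Gd (L2repr u)).

Definition ofsec v : L2 mu := L2class mu (unsec (dirint_repr v)).

(** Independence of the representative: by [ae_fiber], functions equal almost everywhere agree on
    almost every whole fibre. *)
Lemma tosec_class F : F \in sqint mu ->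
  tosec (L2class mu F) = dirint_class psi (sec Gd F).
Proof.
move=> sF; apply/dirint_class_eqP; [exact/sec_sqint/L2repr_sqint|exact: sec_sqint|].
have /(ae_fiber psi) := L2repr_class sF.
by apply: filterS => x FF'; exact: sec_eq.
Qed.

Lemma ofsec_class xi : xi \in sqint_section psi ->
  ofsec (dirint_class psi xi) = L2class mu (unsec xi).
Proof.
move=> sxi; apply: L2class_eq.
- exact/(sqint_sectionP psi)/dirint_repr_sqint.
- by apply/(sqint_sectionP psi); exact: sxi.
apply/(ae_fiber psi); apply: filterS (dirint_repr_class sxi) => x xix g xg.
by rewrite !(unsecE _ xg) xix.
Qed.

Lemma tosecK : cancel tosec ofsec.
Proof.
move=> u; have su := L2repr_sqint u.
rewrite ofsec_class ?sec_sqint// -[RHS]L2class_repr; apply: L2class_eq => //.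
  exact/(sqint_sectionP psi)/sec_sqint.
exact: (secK psi).
Qed.

Lemma ofsecK : cancel ofsec tosec.
Proof.
move=> v; rewrite tosec_class ?unsecK ?dirint_class_repr//.
exact/(sqint_sectionP psi)/dirint_repr_sqint.
Qed.

Lemma tosec_is_linear : linear tosec.
Proof.
move=> a u v; have [su sv] := (L2repr_sqint u, L2repr_sqint v).
have suv : a *: L2repr u + L2repr v \in sqint mu by rewrite rpredD// rpredZ.
rewrite -{1}(L2class_repr u) -{1}(L2class_repr v) -L2class_lin// tosec_class//.
rewrite -(dirint_class_lin a (sec_sqint psi su) (sec_sqint psi sv)).
apply/dirint_class_eqP.
- exact: sec_sqint.
- by apply: sqint_section_lin; exact: sec_sqint.
- exact: (sec_lin psi).
Qed.

HB.instance Definition _ := GRing.isLinear.Build R[i] (L2 mu) (dirint psi) _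
  tosec tosec_is_linear.

Lemma tosec_inner u u' : dirint_inner (tosec u) (tosec u') = L2inner u u'.
Proof.
have [su su'] := (L2repr_sqint u, L2repr_sqint u').
rewrite dirint_inner_class ?sec_sqint// /L2inner (cintegral_fiber psi su su').
have [mu_ mu_'] : cmeasurable (L2repr u) /\ cmeasurable (L2repr u').
  by move/sqintP : su => [? _]; move/sqintP : su' => [? _].
apply: cintegral_ae_eq.
- by apply: cmeasurable_l2inner; exact: sec_sqint.
- have [mr mi] := cmeasurable_mul_conj mu_ mu_'.
  by split; exact: (measurable_rsum_fiber psi).
apply: filterS2 (ae_summable_on psi su) (ae_summable_on psi su') => x ux u'x.
by rewrite /l2inner; congr Complex; apply: eq_rsum => g xg; rewrite !secE.
Qed.

Lemma tosec_l2sum F : F \in sqint mu ->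
  {ae mu0, forall x, is_l2sum F (dirint_repr (tosec (L2class mu F)) x)}.
Proof.
move=> sF; rewrite tosec_class//.
apply: filterS2 (dirint_repr_class (sec_sqint psi sF)) (ae_summable_on psi sF).
by move=> x -> Fx; apply: l2_is_l2sum => g xg; rewrite secE.
Qed.

End direct_integral.

(** * Decomposable operators *)

Section opfields.
Context (R : realType) (d0 d : measure_display).
Context (G0 : measurableType d0) (G : measurableType d).
Variable Gd : discrete_measured_groupoid R G0 G.
Notation mu0 := (obj_measure Gd).
Notation mu := (mor_measure Gd).
Variable psi : edge_partition Gd.
Implicit Types (xi eta : hsection Gd) (B C : opfield Gd).

Definition mklin (U V : lmodType R[i]) (f : U -> V) (lf : linear f) :
    {linear U -> V} :=
  HB.pack f (GRing.isLinear.Build R[i] U V _ f lf).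

Definition op_section B xi : hsection Gd := fun x => B x (xi x).

(** Squared norms let inequalities between fibre sums be used directly. The bound holds at every
    object, so it passes to sums and compositions without handling null sets. *)
Definition unif_bounded B := exists2 M : R, 0 <= M &
  forall x a, l2norm (B x a) ^+ 2 <= M * l2norm a ^+ 2.

Definition admissible B := unif_bounded B /\
  forall xi, measurable_section psi xi -> measurable_section psi (op_section B xi).

Lemma l2norm_ge0 (T : choiceType) (A : set T) (a : l2 R A) : 0 <= l2norm a.
Proof. exact: sqrtr_ge0. Qed.

Lemma admissible_ess_bounded B : admissible B -> ess_bounded_opfield psi B.
Proof.
move=> [[M M0 BM] mB].
have BM' x a : l2norm (B x a) <= Num.sqrt M * l2norm a.
  rewrite -(ger0_norm (l2norm_ge0 (B x a))) -(ger0_norm (l2norm_ge0 a)).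
  by rewrite -!sqrtr_sqr -sqrtrM// ler_wsqrtr.
split=> [x|//|]; first by exists (Num.sqrt M) => a; exact: BM'.
by exists (Num.sqrt M); exact: aeW.
Qed.

Lemma op_section_sqint B xi : admissible B -> xi \in sqint_section psi ->
  op_section B xi \in sqint_section psi.
Proof.
move=> [[M M0 BM] mB]; rewrite inE => -[mxi Ixi]; rewrite inE; split; first exact: mB.
have n0 eta x : (0 <= (l2norm (eta x) ^+ 2)%:E)%E by rewrite lee_fin sqr_ge0.
apply: (@le_lt_trans _ _ (\int[mu0]_x (M%:E * (l2norm (xi x) ^+ 2)%:E))%E).
  apply: ge0_le_integral => //.
  - exact: (measurable_l2norm_sqr (mB _ mxi)).
  - by apply: measurable_funeM; exact: measurable_l2norm_sqr.
  - by move=> x _; rewrite -EFinM lee_fin; exact: BM.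
rewrite ge0_integralZl//; last exact: measurable_l2norm_sqr.
by rewrite lte_mul_pinfty.
Qed.

(** A field of operators acts fibre by fibre, so it respects almost everywhere equality and the
    chosen representative disappears. *)
Lemma dirint_op_class B xi : admissible B -> xi \in sqint_section psi ->
  dirint_op B (dirint_class psi xi) = dirint_class psi (op_section B xi).
Proof.
move=> aB sxi; apply/dirint_class_eqP.
- exact: op_section_sqint aB (dirint_repr_sqint _).
- exact: op_section_sqint aB sxi.
by apply: filterS (dirint_repr_class sxi) => x; exact: (f_equal (B x)).
Qed.

Lemma lin_opfield_is_linear (k : R[i]) B C x :
  linear (fun a => k *: B x a + C x a).
Proof.
move=> c a b; rewrite (linearP (B x)) (linearP (C x)) !scalerDr.
rewrite !scalerA (mulrC k) -!scalerA.
by rewrite addrACA.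
Qed.

(** One construction serves for sums, with [k = 1], and for opposites, with [k = -2] and equal
    fields. *)
Definition lin_opfield k B C : opfield Gd :=
  fun x => mklin (@lin_opfield_is_linear k B C x).

Lemma comp_opfield_is_linear B C x : linear (fun a => B x (C x a)).
Proof. by move=> c a b; rewrite (linearP (C x)) (linearP (B x)). Qed.

Definition comp_opfield B C : opfield Gd :=
  fun x => mklin (@comp_opfield_is_linear B C x).

Lemma admissible_lin k B C : admissible B -> admissible C ->
  admissible (lin_opfield k B C).
Proof.
move=> [[M M0 BM] mB] [[N N0 CN] mC]; split; last first.
  by move=> xi mxi; apply: (measurable_section_lin k); [exact: mB|exact: mC].
have k0 : 0 <= 2 * sqnorm k by rewrite mulr_ge0// sqnorm_ge0.
exists (2 * sqnorm k * M + 2 * N) => [|x a].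
  by rewrite addr_ge0 // mulr_ge0.
have := l2norm_sqr_lin k (B x a) (C x a).
rewrite -!EFinM -EFinD lee_fin => /le_trans; apply.
rewrite [leRHS]mulrDl -[2 * sqnorm k * M * _]mulrA -[2 * N * _]mulrA.
by rewrite lerD// ler_wpM2l.
Qed.

Lemma admissible_comp B C : admissible B -> admissible C ->
  admissible (comp_opfield B C).
Proof.
move=> [[M M0 BM] mB] [[N N0 CN] mC]; split; last first.
  by move=> xi mxi; apply: (mB (op_section C xi)); exact: mC.
exists (M * N) => [|x a]; first exact: mulr_ge0.
by rewrite (le_trans (BM _ _))// -mulrA ler_wpM2l.
Qed.

(** The invariant of the induction on the groupoid ring. *)
Definition intertwines (T : L2 mu -> L2 mu) B :=
  admissible B /\ forall u, tosec psi (T u) = dirint_op B (tosec psi u).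

Lemma intertwines_lin k S T B C : intertwines S B -> intertwines T C ->
  intertwines (fun u => k *: S u + T u) (lin_opfield k B C).
Proof.
move=> [aB SB] [aC TC]; split=> [|u]; first exact: admissible_lin.
rewrite tosec_is_linear SB TC /dirint_op.
have su := dirint_repr_sqint (tosec psi u).
exact/esym/(dirint_class_lin k (op_section_sqint aB su) (op_section_sqint aC su)).
Qed.

Lemma intertwines_comp S T B C : intertwines S B -> intertwines T C ->
  intertwines (fun u => S (T u)) (comp_opfield B C).
Proof.
move=> [aB SB] [aC TC]; split=> [|u]; first exact: admissible_comp.
have su := dirint_repr_sqint (tosec psi u).
rewrite SB TC; exact: (dirint_op_class aB (op_section_sqint aC su)).
Qed.

Lemma intertwines_decomposes T B : intertwines T B ->
  decomposes (tosec psi \o T \o ofsec (psi := psi)) B.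
Proof.
move=> [aB TB]; split; first exact: admissible_ess_bounded.
by apply/funext => v; rewrite /= TB ofsecK.
Qed.

End opfields.

(** * Edges and bounded functions acting on the fibres *)

Section generators.
Context (R : realType) (d0 d : measure_display).
Context (G0 : measurableType d0) (G : measurableType d).
Variable Gd : discrete_measured_groupoid R G0 G.
Notation mu0 := (obj_measure Gd).
Notation mu := (mor_measure Gd).
Notation gsrc := (gsrc Gd).
Notation grng := (grng Gd).
Notation gcomp := (gcomp Gd).
Notation fiber := (fiber Gd).
Variable psi : edge_partition Gd.
Implicit Types (phi : edge Gd) (xi : hsection Gd) (F : G -> R[i]).

Lemma edge_act_in phi F g : einv_dom phi (grng g) ->
  edge_act phi F g = F (eshift phi g).
Proof. by move=> pg; rewrite /edge_act asboolT. Qed.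

Lemma edge_act_out phi F g : ~ einv_dom phi (grng g) -> edge_act phi F g = 0.
Proof. by move=> pg; rewrite /edge_act asboolF. Qed.

(* The right translation [eshift phi] is injective and preserves fibres. *)
Lemma esum_edge_act_le phi F x :
  (\esum_(g in fiber x) (sqnorm (edge_act phi F g))%:E <=
   \esum_(g in fiber x) (sqnorm (F g))%:E)%E.
Proof.
pose D := fiber x `&` [set g | einv_dom phi (grng g)].
have -> : \esum_(g in fiber x) (sqnorm (edge_act phi F g))%:E =
    \esum_(g in D) (sqnorm (F (eshift phi g)))%:E.
  rewrite [RHS]esum_mkcondr; apply: eq_esum => g xg.
  have [pg|pg] := pselect (einv_dom phi (grng g)).
    by rewrite edge_act_in// mem_set.
  by rewrite edge_act_out// memNset// sqnorm0.
rewrite -(esum_image D (eshift phi) (fun g => (sqnorm (F g))%:E)); last first.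
  move=> g h; rewrite !inE => -[_ pg] [_ ph] gh.
  by rewrite -(eshift_inv pg).2 -(eshift_inv ph).2 gh.
rewrite [leRHS](esumID (eshift phi @` D)); last first.
  by move=> g _; rewrite lee_fin sqnorm_ge0.
rewrite (_ : fiber x `&` eshift phi @` D = eshift phi @` D).
  by rewrite leeDl// esum_sqnorm_ge0.
apply/setIidr => _ [g [xg pg] <-]; rewrite /Defs.fiber /=.
by rewrite gsrc_eshift.
Qed.

Lemma edge_act_sqsummable phi x (a : l2 R (fiber x)) :
  edge_act phi a \in sqsummable (fiber x).
Proof.
rewrite inE; split=> [g xg|].
  have [pg|pg] := pselect (einv_dom phi (grng g)).
    rewrite edge_act_in// l2_out//; apply: contra_not xg.
    by rewrite /Defs.fiber /= gsrc_eshift.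
  exact: edge_act_out.
apply: le_lt_trans (esum_edge_act_le phi a x) _.
by rewrite -l2norm_sqr ltry.
Qed.

Definition edge_fop phi x (a : l2 R (fiber x)) : l2 R (fiber x) :=
  L2Fam (edge_act_sqsummable phi a).

Lemma edge_fop_is_linear phi x : linear (@edge_fop phi x).
Proof.
move=> k a b; apply: l2_eq => g _.
rewrite -[LHS]/(edge_act phi (k *: a + b : l2 R (fiber x)) g).
rewrite -[RHS]/(k * edge_act phi a g + edge_act phi b g).
have [pg|pg] := pselect (einv_dom phi (grng g)).
  by rewrite !edge_act_in.
by rewrite !edge_act_out// mulr0 addr0.
Qed.

Definition edge_opfield phi : opfield Gd :=
  fun x => mklin (@edge_fop_is_linear phi x).

(** A partial translation only moves or drops coordinates, so the bound is 1. It preserves sources,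
    so [unsec] turns the fibrewise action into [edge_act], which preserves measurability. *)
Lemma admissible_edge phi : admissible psi (edge_opfield phi).
Proof.
split=> [|xi /measurable_sectionP mxi]; last first.
  apply/measurable_sectionP.
  have := measurable_edge_act psi phi mxi; congr cmeasurable.
  apply/funext => g; rewrite /unsec /op_section.
  rewrite -[RHS]/(edge_act phi (xi (gsrc g)) g).
  have [pg|pg] := pselect (einv_dom phi (grng g)).
    by rewrite !edge_act_in// gsrc_eshift.
  by rewrite !edge_act_out.
exists 1 => // x a; rewrite mul1r -lee_fin !l2norm_sqr.
exact: esum_edge_act_le.
Qed.

Lemma edge_act_sqint phi F : F \in sqint mu -> edge_act phi F \in sqint mu.
Proof.
move=> /sqintP[mF IF]; have mpF := measurable_edge_act psi phi mF.
apply/sqintP; split => //; apply: le_lt_trans IF.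
have s0 (H : G -> R[i]) g : (0 <= (sqnorm (H g))%:E)%E by rewrite lee_fin sqnorm_ge0.
have [mS mS'] := (measurable_sqnorm mF, measurable_sqnorm mpF).
rewrite !(ge0_integral_fiber psi)//; apply: ge0_le_integral => //.
- by move=> x _; exact: esum_sqnorm_ge0.
- exact: (measurable_esum_fiber psi).
- exact: (measurable_esum_fiber psi).
- by move=> x _; exact: esum_edge_act_le.
Qed.

Lemma intertwines_edge phi :
  intertwines psi (edge_op phi) (edge_opfield phi).
Proof.
split=> [|u]; first exact: admissible_edge.
have su := L2repr_sqint u; have spu := edge_act_sqint phi su.
have aE := admissible_edge phi.
rewrite /edge_op (tosec_class psi spu).
transitivity (dirint_class psi (op_section (edge_opfield phi) (sec Gd (L2repr u)))).
  apply/dirint_class_eqP.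
  - exact: sec_sqint.
  - exact: op_section_sqint aE (sec_sqint psi su).
  apply: filterS2 (ae_summable_on psi su) (ae_summable_on psi spu) => x ux pux.
  apply: l2_eq => g xg; rewrite secE//.
  rewrite -[RHS]/(edge_act phi (sec Gd (L2repr u) x) g).
  have [pg|pg] := pselect (einv_dom phi (grng g)).
    by rewrite !edge_act_in// secE// /Defs.fiber /= gsrc_eshift.
  by rewrite !edge_act_out.
exact/esym/(dirint_op_class aE (sec_sqint psi su)).
Qed.

Lemma sqnormM (z w : R[i]) : sqnorm (z * w) = sqnorm z * sqnorm w.
Proof. by case: z w => [a b] [p q]; rewrite /sqnorm /=; ring. Qed.

Section multiplication.
Variables (f : G0 -> R[i]) (M : R).
Hypothesis (mf : cmeasurable f) (fM : forall y, sqnorm (f y) <= M).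

Let M0 : 0 <= M.
Proof. exact: le_trans (sqnorm_ge0 _) (fM point). Qed.

Lemma sqnorm_mult_act_le F g : sqnorm (mult_act Gd f F g) <= M * sqnorm (F g).
Proof. by rewrite sqnormM ler_wpM2r// sqnorm_ge0. Qed.

Lemma esum_mult_act_le F x :
  (\esum_(g in fiber x) (sqnorm (mult_act Gd f F g))%:E <=
   M%:E * \esum_(g in fiber x) (sqnorm (F g))%:E)%E.
Proof.
apply: le_trans (le_esumZ _ M0 (fun g => sqnorm_ge0 (F g))).
by apply: le_esum => g _; rewrite lee_fin; exact: sqnorm_mult_act_le.
Qed.

Lemma mult_act_sqsummable x (a : l2 R (fiber x)) :
  mult_act Gd f a \in sqsummable (fiber x).
Proof.
rewrite inE; split=> [g xg|]; first by rewrite /mult_act l2_out// mulr0.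
apply: le_lt_trans (esum_mult_act_le a x) _.
by rewrite -l2norm_sqr -EFinM ltry.
Qed.

Definition mult_fop x (a : l2 R (fiber x)) : l2 R (fiber x) :=
  L2Fam (mult_act_sqsummable a).

Lemma mult_fop_is_linear x : linear (@mult_fop x).
Proof.
move=> k a b; apply: l2_eq => g _.
rewrite -[LHS]/(f (grng g) * (k * a g + b g)).
rewrite -[RHS]/(k * (f (grng g) * a g) + f (grng g) * b g).
by rewrite mulrDr mulrCA.
Qed.

Definition mult_opfield : opfield Gd := fun x => mklin (@mult_fop_is_linear x).

Lemma admissible_mult : admissible psi mult_opfield.
Proof.
split=> [|xi /measurable_sectionP mxi]; last first.
  apply/measurable_sectionP; have := measurable_mult_act Gd mf mxi.
  by congr cmeasurable; apply/funext.
exists M => // x a; rewrite -lee_fin [leRHS]EFinM !l2norm_sqr.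
exact: esum_mult_act_le.
Qed.

Lemma mult_act_sqint F : F \in sqint mu -> mult_act Gd f F \in sqint mu.
Proof.
move=> /sqintP[mF IF]; have mfF := measurable_mult_act Gd mf mF.
apply/sqintP; split => //.
have s0 (H : G -> R[i]) g : (0 <= (sqnorm (H g))%:E)%E by rewrite lee_fin sqnorm_ge0.
have [mS mS'] := (measurable_sqnorm mF, measurable_sqnorm mfF).
apply: (@le_lt_trans _ _ (\int[mu]_g (M%:E * (sqnorm (F g))%:E))%E).
  apply: ge0_le_integral => //; first exact: measurable_funeM.
  by move=> g _; rewrite -EFinM lee_fin; exact: sqnorm_mult_act_le.
by rewrite ge0_integralZl// lte_mul_pinfty.
Qed.

(** The fibre operators need the everywhere bounded [f], while the ring element is given by [f']. By
    [ae_grng], a change on a null set of objects affects multiplication only on a null set of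
    arrows. *)
Lemma intertwines_mult (f' : G0 -> R[i]) : cmeasurable f' ->
  {ae mu0, forall y, f' y = f y} ->
  intertwines psi (mult_op (Gd := Gd) f') mult_opfield.
Proof.
move=> mf' ff'; split=> [|u]; first exact: admissible_mult.
have su := L2repr_sqint u; have sfu := mult_act_sqint su.
have muf : {ae mu, forall g, mult_act Gd f' (L2repr u) g =
    mult_act Gd f (L2repr u) g}.
  by apply: filterS (ae_grng psi ff') => g fg; rewrite /mult_act fg.
have sfu' : mult_act Gd f' (L2repr u) \in sqint mu.
  apply: (sqint_ae_eq sfu); last by apply: filterS muf => g ->.
  by apply: measurable_mult_act => //; have /sqintP[] := su.
have aM := admissible_mult.
rewrite /mult_op (L2class_eq sfu' sfu muf) (tosec_class psi sfu).
transitivity (dirint_class psi (op_section mult_opfield (sec Gd (L2repr u)))).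
  apply/dirint_class_eqP.
  - exact: sec_sqint.
  - exact: op_section_sqint aM (sec_sqint psi su).
  apply: filterS2 (ae_summable_on psi su) (ae_summable_on psi sfu) => x ux fux.
  apply: l2_eq => g xg; rewrite secE//.
  rewrite -[RHS]/(f (grng g) * sec Gd (L2repr u) x g).
  by rewrite secE.
exact/esym/(dirint_op_class aM (sec_sqint psi su)).
Qed.

Lemma mult_opfield_zeta x a :
  mult_opfield x (zeta R (fiber x) a) = f (grng a) *: zeta R (fiber x) a.
Proof.
apply: l2_eq => g _.
rewrite -[LHS]/(f (grng g) * zeta R (fiber x) a g).
rewrite -[RHS]/(f (grng a) * zeta R (fiber x) a g) zetaE.
by case: eqP => [->//|_]; rewrite andbF !mulr0.
Qed.

End multiplication.

(** The value at [g] is that of the basis vector at [eshift phi g], so the mass moves to the only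
    [g] that shifts to [a], namely [a] followed by [phi]. Such a [g] exists exactly when [grng a]
    lies in [edom phi]. *)
Lemma edge_opfield_zeta phi x a : fiber x a ->
  edge_opfield phi x (zeta R (fiber x) a) =
  if `[< edom phi (grng a) >]
  then zeta R (fiber x) (gcomp a (phi (grng a))) else 0.
Proof.
move=> xa; apply: l2_eq => g xg.
rewrite -[LHS]/(edge_act phi (zeta R (fiber x) a) g).
have [pg|pg] := pselect (einv_dom phi (grng g)).
  rewrite edge_act_in// zetaE asboolT//=; have [pe pgE] := eshift_inv pg.
  have [<-|ga] := eqVneq (eshift phi g) a.
    rewrite asboolT// zetaE pgE eqxx asboolT//.
  case: asboolP => // pa; rewrite zetaE; have [_ aE] := eshiftK pa.
  case: eqP => [gE|_]; last by rewrite andbF.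
  by move/eqP : ga; rewrite gE.
rewrite edge_act_out//; case: asboolP => // pa; rewrite zetaE.
have [pE _] := eshiftK pa.
by case: eqP => [gE|_]; [rewrite gE in pg|rewrite andbF].
Qed.

End generators.

(** * The groupoid ring, its fibre operators and the trace *)

Section groupoid_ring.
Context (R : realType) (d0 d : measure_display).
Context (G0 : measurableType d0) (G : measurableType d).
Variable Gd : discrete_measured_groupoid R G0 G.
Notation mu0 := (obj_measure Gd).
Notation mu := (mor_measure Gd).
Notation gsrc := (gsrc Gd).
Notation grng := (grng Gd).
Notation gid := (gid Gd).
Notation fiber := (fiber Gd).
Variable psi : edge_partition Gd.
Implicit Types (phi : edge Gd) (xi : hsection Gd).

(** Truncate [f] to zero where [sqnorm (f y)] exceeds [M ^+ 2], for an essential bound [M] of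
    [f]. *)
Lemma Linfty_bounded_version (f : G0 -> R[i]) : Linfty mu0 f ->
  exists (f' : G0 -> R[i]) (M : R), [/\ cmeasurable f',
    forall y, sqnorm (f' y) <= M & {ae mu0, forall y, f y = f' y}].
Proof.
move=> [mf [M fM]]; have [mr mi] := mf.
have mS : measurable [set y | sqnorm (f y) <= M ^+ 2].
  have := emeasurable_fun_infty_c measurableT (measurable_sqnorm mf) (M ^+ 2)%:E.
  by rewrite setTI; congr measurable; apply/seteqP; split=> y /=; rewrite lee_fin.
exists (fun y => if `[< [set y | sqnorm (f y) <= M ^+ 2] y >] then f y else 0).
exists (M ^+ 2); split.
- split.
    rewrite (_ : (fun _ => _) = fun y =>
        if `[< [set y | sqnorm (f y) <= M ^+ 2] y >] then Re (f y) else 0).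
      by apply: measurable_if_asbool => //; exact: measurable_funTS.
    by apply/funext => y; case: asboolP.
  rewrite (_ : (fun _ => _) = fun y =>
      if `[< [set y | sqnorm (f y) <= M ^+ 2] y >] then Im (f y) else 0).
    by apply: measurable_if_asbool => //; exact: measurable_funTS.
  by apply/funext => y; case: asboolP.
- by move=> y; case: asboolP => //; rewrite sqnorm0 sqr_ge0.
apply: filterS fM => y fM; rewrite asboolT//=.
have M0 : 0 <= M%:C%C by apply: le_trans fM; exact: normr_ge0.
by rewrite -lecR sqnormE rmorphXn /= lerXn2r.
Qed.

Lemma scaleN2D (V : lmodType R[i]) (v : V) : -2 *: v + v = - v.
Proof. by rewrite scaleNr scaler_nat mulr2n opprD -addrA addNr addr0. Qed.

Lemma groupoid_ring_intertwines T : groupoid_ring T -> exists B, intertwines psi T B.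
Proof.
elim=> [phi|f Lf|S T' _ [B SB] _ [C TC]|T' _ [B TB]|S T' _ [B SB] _ [C TC]].
- by exists (edge_opfield phi); exact: intertwines_edge.
- have [f' [M [mf' f'M ff']]] := Linfty_bounded_version Lf.
  by exists (mult_opfield Gd f'M); apply: intertwines_mult => //; case: Lf.
- exists (lin_opfield 1 B C).
  rewrite (_ : (fun u => S u + T' u) = (fun u => 1 *: S u + T' u)).
    exact: intertwines_lin.
  by apply/funext => u; rewrite scale1r.
- exists (lin_opfield (-2) B B).
  rewrite (_ : (fun u => - T' u) = (fun u => -2 *: T' u + T' u)).
    exact: intertwines_lin.
  by apply/funext => u; rewrite scaleN2D.
- by exists (comp_opfield B C); exact: intertwines_comp.
Qed.

Lemma unsec_edge_section phi g :
  unsec (edge_section phi) g = (`[< eimg phi g >])%:R.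
Proof.
rewrite /unsec /edge_section; have [pg|pg] := pselect (edom phi (gsrc g)).
  rewrite asboolT// zetaE asboolT ?gsrc_efun//=; last exact: gsrc_efun.
  congr (_%:R); congr nat_of_bool; apply/eqP/asboolP.
    by move=> gE; apply/eimgP; split.
  by move=> /eimgP[].
by rewrite !asboolF// => /eimgP[].
Qed.

(** The squared norm is [mu (eimg phi)], which equals [mu0 (edom phi)] by change of variables and is
    finite because [mu0] is. *)
Lemma edge_section_sqint phi : edge_section phi \in sqint_section psi.
Proof.
apply/sqint_sectionP/sqintP.
have mphi := measurable_eimg phi.
have -> : unsec (edge_section phi) = fun g => (`[< eimg phi g >])%:R.
  by apply/funext => g; exact: unsec_edge_section.
split; first split.
- rewrite (_ : (fun _ => _) = fun g => if `[< eimg phi g >] then 1 else 0).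
    exact: measurable_if_asbool.
  by apply/funext => g; case: asboolP.
- by rewrite (_ : (fun _ => _) = cst 0)//; apply/funext => g; case: asboolP.
rewrite (eq_integral (fun g => (\1_(eimg phi) g)%:E)); last first.
  move=> g _; rewrite indicE; have [pg|pg] := pselect (eimg phi g).
    by rewrite asboolT// mem_set// /sqnorm /= expr1n expr0n addr0.
  by rewrite asboolF// memNset// sqnorm0.
rewrite integral_indic// setIT -(mul1e (mu _)) -integral_cst//.
rewrite (@ge0_integral_eimg _ _ _ _ _ _ phi (cst 1%E))// integral_cst//; last first.
  exact: measurable_edom.
by rewrite mul1e ltey_eq fin_num_measure//; exact: measurable_edom.
Qed.

(** Its section takes the basis vector of the identity at each object, and its image is the set of
    units; it is the counterpart of [chi0] in the direct integral. *)
Definition id_edge : edge Gd.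
Proof.
apply: (@Edge _ _ _ _ _ Gd setT gid) => //.
- exact: measurable_gid_fun.
- by move=> x _; exact: gsrc_id.
- by move=> x y _ _; rewrite !grng_id.
Defined.

Lemma tosec_chi0 : tosec psi (chi0 Gd) = dirint_class psi (edge_section id_edge).
Proof.
have sS := edge_section_sqint id_edge.
rewrite -[in RHS](unsecK (edge_section id_edge)) -tosec_class; last first.
  exact/(sqint_sectionP psi).
congr (tosec psi (L2class _ _)); apply/funext => g.
by rewrite unsec_edge_section.
Qed.

(** [tosec] preserves inner products, carries [T] to the field [B] and [chi0] to the section of
    [id_edge]. *)
Lemma trace_intertwines T (B : opfield Gd) : intertwines psi T B ->
  trace T = cintegral mu0 (fun x =>
    l2inner (B x (zeta R (fiber x) (gid x))) (zeta R (fiber x) (gid x))).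
Proof.
move=> [aB TB]; have sS := edge_section_sqint id_edge.
have SE x : edge_section id_edge x = zeta R (fiber x) (gid x).
  by rewrite /edge_section asboolT.
rewrite /trace -(tosec_inner psi) TB tosec_chi0 (dirint_op_class aB sS).
rewrite (dirint_inner_class (op_section_sqint aB sS) sS).
by congr cintegral; apply/funext => x; rewrite /op_section SE.
Qed.

(** [dirint_class] is only known to be additive on square-integrable sections, so membership is
    carried along the sum. *)
Lemma dirint_class_sum n (xi : 'I_n -> hsection Gd) :
  (forall i, xi i \in sqint_section psi) ->
  \sum_(i < n) xi i \in sqint_section psi /\
  dirint_class psi (\sum_(i < n) xi i) = \sum_(i < n) dirint_class psi (xi i).
Proof.
move=> sxi.
have s0 : (0 : hsection Gd) \in sqint_section psi.
  exact: (sqint_section_submod_closed psi).1.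
elim/big_ind2: _ => [|_ xi1 _ xi2 [s1 <-] [s2 <-]|i _]; last by [].
  (* The class [c] of the zero section satisfies [c = c + c], so it vanishes. *)
  split=> //; have := dirint_class_lin 1 s0 s0.
  by rewrite !scale1r addr0 => /eqP; rewrite -subr_eq0 opprD addrA subrr sub0r
    oppr_eq0 => /eqP.
have s12 := sqint_section_lin 1 s1 s2; have d12 := dirint_class_lin 1 s1 s2.
rewrite scale1r in s12; rewrite !scale1r in d12.
exact: conj s12 d12.
Qed.

Lemma hsection_sumE n (xi : 'I_n -> hsection Gd) x :
  (\sum_(i < n) xi i) x = \sum_(i < n) xi i x.
Proof. exact: (big_morph (fun xi : hsection Gd => xi x)). Qed.

(* Both sides of the representation are applied to the sections of the
   partition, which take every basis vector as a value. *)
Lemma intertwines_convop T (B : opfield Gd) n (phi : 'I_n -> edge Gd)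
    (f : 'I_n -> G0 -> R[i]) : intertwines psi T B -> represents phi f T ->
  {ae mu0, forall x, is_convop phi f (B x)}.
Proof.
move=> [aB TB] [Lf TE].
have /choice[f' /choice[M fM]] := fun i => Linfty_bounded_version (Lf i).
have bf i y : sqnorm (f' i y) <= M i by case: (fM i).
pose C i := comp_opfield (edge_opfield (phi i)) (mult_opfield Gd (bf i)).
have TC i : intertwines psi (fun u => edge_op (phi i) (mult_op (f i) u)) (C i).
  apply: intertwines_comp; first exact: intertwines_edge.
  by case: (fM i) => mf' _ ff'; apply: intertwines_mult => //; case: (Lf i).
have BC j : {ae mu0, forall x, B x (edge_section (psi j) x) =
    \sum_(i < n) C i x (edge_section (psi j) x)}.
  have sS := edge_section_sqint (psi j).
  have [sum_s sum_class] := dirint_class_sum (fun i => op_section_sqint (TC i).1 sS).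
  suff : dirint_class psi (op_section B (edge_section (psi j))) =
      dirint_class psi (\sum_(i < n) op_section (C i) (edge_section (psi j))).
    move/(dirint_class_eqP (op_section_sqint aB sS) sum_s); apply: filterS => x Bx.
    by rewrite -[LHS]/(op_section B _ x) Bx hsection_sumE.
  rewrite sum_class -(dirint_op_class aB sS).
  (* Writing the class as the image of an element of [L2 mu] lets the representation of [T] be
     applied to it. *)
  rewrite -(ofsecK (dirint_class psi (edge_section (psi j)))) -TB TE.
  rewrite (big_morph (tosec psi) (raddfD (tosec psi)) (raddf0 (tosec psi))).
  apply: eq_bigr => i _; rewrite (TC i).2 ofsecK.
  exact: (dirint_op_class (TC i).1 sS).
(* Coefficients are evaluated at ranges of arrows, so [f i] and [f' i] must agree at [grng g] for
   every [g] in the fibre, not only at [x]. *)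
have ff' i : {ae mu0, forall x g, fiber x g -> f i (grng g) = f' i (grng g)}.
  by case: (fM i) => _ _ ff'; apply/(ae_fiber psi); exact: (ae_grng psi ff').
(* The partition is countable, so the exceptional sets of all [j] merge into one null set. *)
have BC' := ae_foralln BC.
have ff'' : {ae mu0, forall x i g, fiber x g -> f i (grng g) = f' i (grng g)}.
  exact: filter_forall.
apply: filterS2 BC' ff'' => x BCx fx a xa.
(* The edge of the partition through [a] has the basis vector of [a] as the value of its section at
   [x]. *)
have [j /eimgP[pa paE]] := epart_exists psi a.
rewrite xa in pa paE.
have := BCx j; rewrite /edge_section asboolT// paE => ->.
rewrite [RHS]big_mkcond; apply: eq_bigr => i _.
rewrite -[LHS]/(edge_opfield (phi i) x
  (mult_opfield Gd (bf i) x (zeta R (fiber x) a))).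
rewrite mult_opfield_zeta (linearZ_LR (edge_opfield (phi i) x)).
rewrite edge_opfield_zeta// -fx//.
by case: asboolP => // _; rewrite scaler0.
Qed.

End groupoid_ring.

Theorem proposition2p7 (R : realType) (d0 d : measure_display)
    (G0 : measurableType d0) (G : measurableType d)
    (Gd : discrete_measured_groupoid R G0 G) (psi : edge_partition Gd) :
  exists (Phi : {linear L2 (mor_measure Gd) -> dirint psi})
         (Phi' : dirint psi -> L2 (mor_measure Gd)),
  [/\ cancel Phi Phi' /\ cancel Phi' Phi,
      forall u v, dirint_inner (Phi u) (Phi v) = L2inner u v,
      forall F : G -> R[i], F \in sqint (mor_measure Gd) ->
        {ae obj_measure Gd, forall x,
          is_l2sum F (dirint_repr (Phi (L2class (mor_measure Gd) F)) x)} &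
      forall T, groupoid_ring T ->
        exists B : opfield Gd,
        [/\ decomposes (Phi \o T \o Phi') B,
            forall n (phi : 'I_n -> edge Gd) (f : 'I_n -> G0 -> R[i]),
              represents phi f T ->
              {ae obj_measure Gd, forall x, is_convop phi f (B x)} &
            trace T = cintegral (obj_measure Gd) (fun x =>
              l2inner (B x (zeta R (fiber Gd x) (gid Gd x)))
                      (zeta R (fiber Gd x) (gid Gd x)))]].
Proof.
exists (tosec psi), (@ofsec _ _ _ _ _ Gd psi); split.
- by split; [exact: tosecK|exact: ofsecK].
- exact: tosec_inner.
- exact: tosec_l2sum.
move=> T /(groupoid_ring_intertwines psi)[B TB]; exists B; split.
- exact: intertwines_decomposes TB.
- by move=> n phi f; exact: intertwines_convop TB.
- exact: trace_intertwines TB.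
Qed.
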